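(* Assume (SH), and suppose $H\in C^2(\mathbb{R}^n\times(\mathbb{R}^n\setminus\{0\}))$ and $\phi:\mathbb{R}^n\to\mathbb{R}$ is locally Lipschitz. Let $\overline{x}$ be an optimal solution for $\mathcal{P}(t_0,x_0)$ and suppose that there exists $(q,Q)\in J^{2,+}\phi(\overline{x}(T))$ with $q\neq0$. Let $\overline{p}$ be the dual arc associated with $\overline{x}$ such that $-\overline{p}(T)=q$, and let $R$ be the solution of the Riccati equation $$\dot R(t)+H_{px}[t]R(t)+R(t)H_{xp}[t]+R(t)H_{pp}[t]R(t)+H_{xx}[t]=0,\qquad R(T)=-Q,$$ assumed to be defined on $[a,T]$ for some $a\in[t_0,T)$. Then $$(-\overline{p}(t),-R(t))\in J_x^{2,+}V(t,\overline{x}(t))\quad\text{for all }t\in[a,T].$$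
   Context: Fix $T\in\mathbb{R}$, a multifunction $F:\mathbb{R}^n\rightrightarrows\mathbb{R}^n$ and $\phi:\mathbb{R}^n\to\mathbb{R}$. An arc is an absolutely continuous function on a compact interval. For $(t_0,x_0)\in(-\infty,T]\times\mathbb{R}^n$, the Mayer problem $\mathcal{P}(t_0,x_0)$ is to minimize $\phi(x(T))$ over all arcs $x:[t_0,T]\to\mathbb{R}^n$ with $\dot x(s)\in F(x(s))$ for a.e. $s\in[t_0,T]$ and $x(t_0)=x_0$; a minimizer is called an optimal solution for $\mathcal{P}(t_0,x_0)$. The value function $V:(-\infty,T]\times\mathbb{R}^n\to\mathbb{R}$ is the infimum $V(t_0,x_0)$ of this problem. The Hamiltonian is $H(x,p)=\sup_{v\in F(x)}\langle v,p\rangle$, $x,p\in\mathbb{R}^n$. (SH): (i) $F(x)$ is nonempty, convex, compact for each $x$; (ii) $F$ is locally Lipschitz, i.e. each $x$ has a neighborhood $K$ and a constant $c>0$ with $F(z)\subset F(y)+c|z-y|B(0,1)$ for all $z,y\in K$; (iii) there is $\gamma>0$ with $\max\{|v|:v\in F(x)\}\le\gamma(1+|x|)$ for all $x$. $B(x,\epsilon)$ is the closed ball. A dual arc associated with an optimal $\overline{x}$ is an arc $\overline{p}:[t_0,T]\to\mathbb{R}^n$ with $\dot{\overline{x}}(s)\in\partial_p^-H(\overline{x}(s),\overline{p}(s))$, $-\dot{\overline{p}}(s)\in\partial_x^-H(\overline{x}(s),\overline{p}(s))$ for a.e. $s\in[t_0,T]$ and $-\overline{p}(T)\in\partial\phi(\overline{x}(T))$,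 where $\partial_x^-H,\partial_p^-H$ are the Fréchet subdifferentials of $H(\cdot,p)$, $H(x,\cdot)$ and $\partial\phi$ is the Clarke generalized gradient. The Fréchet subdifferential is $\partial^-f(x)=\{p:\liminf_{y\to x}\frac{f(y)-f(x)-\langle p,y-x\rangle}{|y-x|}\ge0\}$. (A dual arc vanishes either everywhere or nowhere on $[t_0,T]$.) $H_{px}[t]=\nabla^2_{px}H(\overline{x}(t),\overline{p}(t))$ and similarly for $H_{xp}[t],H_{pp}[t],H_{xx}[t]$; here $H_{xp}$ is the Jacobian in $x$ of $\nabla_pH$ and $H_{px}=H_{xp}^*$ is the Jacobian in $p$ of $\nabla_xH$. For $S(n)$ the real symmetric $n\times n$ matrices, the set of superjets $J^{2,+}f(x)$ is the set of $(q,Q)\in\mathbb{R}^n\times S(n)$ such that for some $\delta>0$ and all $y\in B(x,\delta)$, $f(y)\le f(x)+\langle q,y-x\rangle+\frac12\langle Q(y-x),y-x\rangle+o(|y-x|^2)$; $J_x^{2,+}V(t,x)$ denotes the set of superjets of $V(t,\cdot)$ at $x$. *)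

(* Defs.v *)
From mathcomp Require Import all_boot all_order all_algebra.
From mathcomp Require Import all_classical all_reals all_analysis.
Set Implicit Arguments.
Unset Strict Implicit.
Unset Printing Implicit Defensive.
Import Order.TTheory GRing.Theory Num.Theory.
Import numFieldNormedType.Exports.
Local Open Scope ring_scope.
Local Open Scope classical_set_scope.

(* Vectors of R^n are row vectors.  The norm carried by ['rV[R]_n] is the
   sup norm: it is used below only through the topology, differentiability and
   Lipschitz continuity, which do not depend on the norm; wherever |.| itself
   appears it is the Euclidean norm [enorm]. *)

Section Euclidean.
Context {R : realType} {n : nat}.
Implicit Types (x y : 'rV[R]_n) (r : R).

Definition dot x y : R := \sum_i x 0 i * y 0 i.
Definition enorm x : R := Num.sqrt (dot x x).
Definition eball x r : set 'rV[R]_n := [set y | enorm (y - x) <= r].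

End Euclidean.

Section Smoothness.
Context {R : realType}.

(* C^k at every point of U (meant for U open), by iterated directional
   derivatives; in finite dimension this is the usual notion. *)
Fixpoint class_C {V : normedModType R} (k : nat) (U : set V) (f : V -> R) :
    Prop :=
  if k is k'.+1 then
    (forall z, U z -> differentiable f z) /\
    (forall v, class_C k' U (fun z => 'D_v f z))
  else forall z, U z -> {for z, continuous f}.

Definition locally_lipschitz {V : normedModType R} (f : V -> R) : Prop :=
  forall x : V, exists2 U : set V, nbhs x U & [lipschitz f y | y in U].

Context {n : nat}.
Implicit Types (f : 'rV[R]_n -> R) (x : 'rV[R]_n).

Definition grad f x : 'rV[R]_n := \row_i 'D_(delta_mx 0 i) f x.

(* The library's ['J g x] acts on row vectors on the right; its transpose is
   the Jacobian matrix, with entries \partial_j g_i in row i and column j. *)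
Definition Jac (g : 'rV[R]_n -> 'rV[R]_n) x : 'M[R]_n := ('J g x)^T.

Definition frechet_subdiff f x : set 'rV[R]_n :=
  [set p | (0 <= limf_einf
     (fun y => ((f y - f x - dot p (y - x)) / enorm (y - x))%:E) (x^'))%E].

(* Clarke's generalized directional derivative:
   limsup of (f (y + h v) - f y) / h as y --> x and h decreases to 0. *)
Definition clarke_deriv f x (v : 'rV[R]_n) : \bar R :=
  limf_esup (fun yh : 'rV[R]_n * R => ((f (yh.1 + yh.2 *: v) - f yh.1) / yh.2)%:E)
    (filter_prod (nbhs x) 0^'+).

Definition clarke_grad f x : set 'rV[R]_n :=
  [set p | forall v, ((dot p v)%:E <= clarke_deriv f x v)%E].

(* For a row vector z, z *m Q^T is the vector Q z. *)
Definition superjet f x : set ('rV[R]_n * 'M[R]_n) :=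
  [set qQ | qQ.2^T = qQ.2 /\
    exists r : 'rV[R]_n -> R, r =o_x (fun y => enorm (y - x) ^+ 2) /\
    exists2 delta : R, 0 < delta & forall y, eball x delta y ->
      f y <= f x + dot qQ.1 (y - x)
             + 2^-1 * dot ((y - x) *m qQ.2^T) (y - x) + r y].

End Smoothness.

Section Mayer.
Context {R : realType} {n : nat}.
Implicit Types (F : 'rV[R]_n -> set 'rV[R]_n) (phi : 'rV[R]_n -> R).
Implicit Types (x p : R -> 'rV[R]_n) (t T a b : R).

Definition abs_continuous x a b : Prop :=
  forall e : R, 0 < e -> exists2 d : R, 0 < d &
    forall (m : nat) (l r : 'I_m -> R),
      (forall i, a <= l i /\ l i <= r i /\ r i <= b) ->
      trivIset setT (fun i => `]l i, r i[%classic) ->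
      \sum_i (r i - l i) < d ->
      \sum_i enorm (x (r i) - x (l i)) < e.

(* An arc on [t0, T] is represented by a total function on R of which only
   the restriction to [t0, T] matters: the endpoints, where [derivable] would
   look outside the interval, form a null set. *)
Definition trajectory F T (t0 : R) (x0 : 'rV[R]_n) : set (R -> 'rV[R]_n) :=
  [set x | [/\ abs_continuous x t0 T,
    {ae lebesgue_measure, forall s, t0 <= s <= T ->
       derivable x s 1 /\ F (x s) (derive1 x s)} & x t0 = x0]].

Definition optimal F phi T (t0 : R) (x0 : 'rV[R]_n) x : Prop :=
  trajectory F T t0 x0 x /\
  forall y, trajectory F T t0 x0 y -> phi (x T) <= phi (y T).

Definition value F phi T (t0 : R) (x0 : 'rV[R]_n) : R :=
  inf [set phi (x T) | x in trajectory F T t0 x0].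

Definition hamiltonian F (x p : 'rV[R]_n) : R := sup [set dot v p | v in F x].

Definition SH F : Prop :=
  [/\ forall x : 'rV[R]_n, F x !=set0 /\ convex_set (F x) /\ compact (F x),
      forall x : 'rV[R]_n,
        exists2 K : set 'rV[R]_n, nbhs x K &
        exists2 c : R, 0 < c & forall z y, K z -> K y ->
          F z `<=` [set w + (c * enorm (z - y)) *: u | w in F y & u in eball 0 1]
    & exists2 gamma : R, 0 < gamma &
        forall x v : 'rV[R]_n, F x v -> enorm v <= gamma * (1 + enorm x)].

Definition hamiltonian_C2 F : Prop :=
  class_C 2 [set z : 'rV[R]_n * 'rV[R]_n | z.2 != 0]
    (fun z => hamiltonian F z.1 z.2).

Definition dual_arc F phi T (t0 : R) x p : Prop :=
  let H := hamiltonian F in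
  [/\ abs_continuous p t0 T,
    {ae lebesgue_measure, forall s, t0 <= s <= T ->
       [/\ derivable x s 1, derivable p s 1,
           frechet_subdiff (H (x s)) (p s) (derive1 x s) &
           frechet_subdiff (H^~ (p s)) (x s) (- derive1 p s)]}
    & clarke_grad phi (x T) (- p T)].

Section Hessian.
Variable H : 'rV[R]_n -> 'rV[R]_n -> R.
Implicit Types u q : 'rV[R]_n.

Definition grad_x u q := grad (H^~ q) u.
Definition grad_p u q := grad (H u) q.
Definition hess_xx u q := Jac (grad_x^~ q) u.
Definition hess_px u q := Jac (grad_x u) q.
Definition hess_xp u q := Jac (grad_p^~ q) u.
Definition hess_pp u q := Jac (grad_p u) q.

End Hessian.

(* Classical solution on [a, T] of the Riccati equation along (x, p), with
   terminal value P T = PT.  The coefficients being continuous in t, continuity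
   on [a, T] together with the equation on ]a, T[ gives the one-sided
   derivatives at the endpoints. *)
Definition riccati_solution F x p a T (PT : 'M[R]_n) (P : R -> 'M[R]_n) : Prop :=
  let H := hamiltonian F in
  [/\ {within `[a, T], continuous P},
    forall t, a < t < T -> derivable P t 1 /\
      derive1 P t + hess_px H (x t) (p t) *m P t + P t *m hess_xp H (x t) (p t)
      + P t *m hess_pp H (x t) (p t) *m P t + hess_xx H (x t) (p t) = 0
    & P T = PT].

End Mayer.

(* Main.v *)
Require Import Defs.
From mathcomp Require Import all_boot all_order all_algebra.
From mathcomp Require Import all_classical all_reals all_analysis.
From mathcomp Require Import measurable_realfun.
From mathcomp Require Import ring lra.

(** An upper estimate of V(t, .) at x(t) + d0 only requires one good trajectory
    starting from that point.  It is given by the feedback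
      y' = grad_p H(y, p + P (y - x)),   y(t) = x(t) + d0,
    where (x, p) is the optimal pair and P the Riccati matrix.  The right-hand
    side belongs to F(y): at a nonzero covector the gradient of the support
    function H(y, .) is the point of F(y) where the supremum is attained
    ([grad_p_argmax]).  Put d = y - x and
      g = <p, d> + 1/2 <P d, d>.
    The Hamiltonian system satisfied by (x, p), the identity
    <grad_p H(y, k), k> = H(y, k) and the Riccati equation give
      g' = H(x + d, p + P d) - H(x, p) - <grad_x H, d> - <grad_p H, P d>
           - 1/2 D^2 H((d, P d), (d, P d)),
    the derivatives of H being taken at (x, p) ([riccati_form_derive]).  This is
    the second-order Taylor remainder of H in the direction (d, P d), hence
    o(|d|^2) uniformly in time by compactness; as |d| stays bounded by a
    constant times |d0|, g(T) - g(t) = o(|d0|^2) ([riccati_form_estimate]).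
    Since q = - p(T) and Q = - P(T), the superjet inequality for phi at x(T)
    reads phi(y(T)) <= phi(x(T)) - g(T) + o(|d0|^2).  With V(t, x(t)) = phi(x(T))
    ([value_on_optimal]) it becomes the superjet inequality for V(t, .) at x(t),
    with - p(t) and - P(t) ([value_quadratic_bound]).

    Four facts support this computation.
    - The inclusions defining arcs hold almost everywhere only.  An absolutely
      continuous function whose derivative is nonpositive almost everywhere is
      nonincreasing ([scalar_ac_ae_nonincreasing]).  This yields Gronwall's
      inequality for arcs ([gronwall_ae]), therefore the boundedness of the
      reachable sets and the fact that p never vanishes ([dual_arc_neq0]).  It
      also shows that x and p are of class C^1, because the subdifferential
      inclusions single out continuous derivatives ([scalar_ac_ae_C1]).
    - The feedback equation has a solution: its right-hand side is Lipschitz in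
      y near the optimal arc and is truncated away from it ([picard],
      [feedback_solution]).
    - Taylor's formula with a remainder controlled by the oscillation of the
      Hessian ([taylor2]).
    - Superjets only contain symmetric matrices.  By Schwarz's theorem
      ([schwarz]) P and its transpose solve the same Riccati equation, and they
      agree at T ([riccati_symmetric]).

    Arcs matter between a and T only; precomposing them with the retraction [clamp]
    of the line onto that interval makes them continuous everywhere. *)

Set Implicit Arguments.
Unset Strict Implicit.
Unset Printing Implicit Defensive.
Import Order.TTheory GRing.Theory Num.Theory.
Import numFieldNormedType.Exports.
Local Open Scope ring_scope.
Local Open Scope classical_set_scope.

(** * Norms and inner product *)

Lemma coord_norm_le (R : realType) m n (A : 'M[R]_(m, n)) i j : `|A i j| <= `|A|.
Proof.
by rewrite [leRHS]/Num.Def.normr/= mx_normrE; exact: (le_bigmax _ _ (i, j)).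
Qed.

Lemma norm_mx_le (R : realType) m n (A : 'M[R]_(m, n)) (c : R) :
  0 <= c -> (forall i j, `|A i j| <= c) -> `|A| <= c.
Proof.
move=> c0 H; rewrite [leLHS]/Num.Def.normr/= mx_normrE.
by apply: bigmax_le => // -[i j] _; exact: H.
Qed.

Lemma mulmx_norm_le (R : realType) m n k (A : 'M[R]_(m, n)) (B : 'M[R]_(n, k)) :
  `|A *m B| <= n%:R * (`|A| * `|B|).
Proof.
apply: norm_mx_le => [|i j]; first by rewrite !mulr_ge0.
rewrite mxE; apply: (le_trans (ler_norm_sum _ _ _)).
rewrite -[n in n%:R]card_ord mulr_natl -sumr_const; apply: ler_sum => l _.
by rewrite normrM; apply: ler_pM => //; exact: coord_norm_le.
Qed.

Lemma enorm_ge0 (R : realType) n (v : 'rV[R]_n) : 0 <= enorm v.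
Proof. exact: sqrtr_ge0. Qed.

Lemma dot_ge0 (R : realType) n (v : 'rV[R]_n) : 0 <= dot v v.
Proof. by apply: sumr_ge0 => i _; rewrite -expr2 sqr_ge0. Qed.

Lemma enorm_sqr (R : realType) n (v : 'rV[R]_n) : enorm v ^+ 2 = dot v v.
Proof. by rewrite sqr_sqrtr// dot_ge0. Qed.

Lemma coord_enorm_le (R : realType) n (v : 'rV[R]_n) i : `|v 0 i| <= enorm v.
Proof.
rewrite -(ler_pXn2r (n := 2))// ?nnegrE ?enorm_ge0// enorm_sqr real_normK ?num_real//.
rewrite /dot (bigD1 i)//= -expr2 lerDl sumr_ge0// => j _.
by rewrite -expr2 sqr_ge0.
Qed.

Lemma norm_enorm_le (R : realType) n (v : 'rV[R]_n) : `|v| <= enorm v.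
Proof.
by apply: norm_mx_le => [|i j]; rewrite ?enorm_ge0// ord1 coord_enorm_le.
Qed.

Lemma enorm_le_norm (R : realType) n (v : 'rV[R]_n) : enorm v <= n%:R * `|v|.
Proof.
rewrite -(ler_pXn2r (n := 2))// ?nnegrE ?enorm_ge0 ?mulr_ge0// enorm_sqr.
rewrite exprMn; apply: (@le_trans _ _ (\sum_(i < n) `|v| ^+ 2)).
  apply: ler_sum => i _; rewrite -expr2 -[leLHS]real_normK ?num_real//.
  by rewrite lerXn2r ?nnegrE// coord_norm_le.
rewrite sumr_const card_ord -[(`|v| ^+ 2) *+ n]mulr_natl ler_wpM2r ?sqr_ge0//.
by rewrite -natrX ler_nat; case: (n) => // k; rewrite leq_pmull.
Qed.

Lemma enorm_le_sum (R : realType) n (v : 'rV[R]_n) : enorm v <= \sum_i `|v 0 i|.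
Proof.
rewrite -(ler_pXn2r (n := 2))// ?nnegrE ?enorm_ge0 ?sumr_ge0// enorm_sqr.
rewrite expr2 mulr_suml; apply: ler_sum => i _.
rewrite -expr2 -[leLHS]real_normK ?num_real// expr2 ler_wpM2l//.
by rewrite (bigD1 i)//= lerDl sumr_ge0.
Qed.

Section Dot.
Context {R : realType} {n : nat}.
Implicit Types u v w : 'rV[R]_n.

Lemma dotC u v : dot u v = dot v u.
Proof. by apply: eq_bigr => i _; rewrite mulrC. Qed.

Lemma dotDl u v w : dot (u + v) w = dot u w + dot v w.
Proof. by rewrite /dot -big_split; apply: eq_bigr => i _; rewrite mxE mulrDl. Qed.

Lemma dotZl (c : R) u w : dot (c *: u) w = c * dot u w.
Proof. by rewrite /dot mulr_sumr; apply: eq_bigr => i _; rewrite mxE mulrA. Qed.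

Lemma dotNl u w : dot (- u) w = - dot u w.
Proof. by rewrite -scaleN1r dotZl mulN1r. Qed.

Lemma dotDr u v w : dot w (u + v) = dot w u + dot w v.
Proof. by rewrite !(dotC w) dotDl. Qed.

Lemma dotZr (c : R) u w : dot w (c *: u) = c * dot w u.
Proof. by rewrite !(dotC w) dotZl. Qed.

Lemma dotNr u w : dot w (- u) = - dot w u.
Proof. by rewrite !(dotC w) dotNl. Qed.

Lemma dot_delta u i : dot u (delta_mx 0 i) = u 0 i.
Proof.
rewrite /dot (bigD1 i)//= big1 ?addr0 => [|j ji]; rewrite mxE eqxx.
  by rewrite eqxx mulr1.
by rewrite (negbTE ji) mulr0.
Qed.

Lemma dot_norm_le u v : `|dot u v| <= n%:R * (`|u| * `|v|).
Proof.
apply: (le_trans (ler_norm_sum _ _ _)).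
rewrite -[n in n%:R]card_ord mulr_natl -sumr_const; apply: ler_sum => i _.
by rewrite normrM; apply: ler_pM => //; exact: coord_norm_le.
Qed.

Lemma differentiable_dot u v : differentiable (fun p => dot u p) v.
Proof.
have -> : (fun p => dot u p) = \sum_(i < n) (fun p : 'rV[R]_n => u 0 i * p 0 i).
  by apply/funext => y; rewrite fct_sumE.
apply: differentiable_sum => i.
apply: (@differentiableZ _ _ _ (fun p : 'rV[R]_n => p 0 i)).
exact: differentiable_coord.
Qed.

Lemma dot_continuous u : continuous (fun v => dot v u).
Proof.
have -> : (fun v => dot v u) = dot u by apply/funext => v; rewrite dotC.
by move=> v; apply: differentiable_continuous; exact: differentiable_dot.
Qed.

Lemma dotE u v : dot u v = (u *m v^T) 0 0.
Proof. by rewrite !mxE; apply: eq_bigr => i _; rewrite mxE. Qed.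

Lemma dot_mulmx u v (A : 'M[R]_n) : dot (u *m A) v = dot u (v *m A^T).
Proof. by rewrite !dotE trmx_mul trmxK mulmxA. Qed.

Lemma dot_mulmxE u v (A : 'M[R]_n) : dot (u *m A) v = \sum_i \sum_j u 0 i * v 0 j * A i j.
Proof.
rewrite exchange_big/=; apply: eq_bigr => j _; rewrite mxE mulr_suml.
by apply: eq_bigr => i _; ring.
Qed.

End Dot.

(** * Absolutely continuous functions of a real variable *)

(** The scalar form of [abs_continuous], tested on the same families of
    intervals; vector arcs are handled coordinate by coordinate through
    [abs_continuousP]. *)
Definition scalar_ac (R : realType) (f : R -> R) (a b : R) : Prop :=
  forall e : R, 0 < e -> exists2 d : R, 0 < d &
    forall (m : nat) (l r : 'I_m -> R),
      (forall i, a <= l i /\ l i <= r i /\ r i <= b) ->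
      trivIset setT (fun i => `]l i, r i[%classic) ->
      \sum_i (r i - l i) < d ->
      \sum_i `|f (r i) - f (l i)| < e.

(** The stability properties below all come from this one: the sum of finitely
    many increments that become small together is small. *)
Lemma scalar_ac_dominated (R : realType) (I : finType) (g : I -> R -> R)
    (f : R -> R) (a b K : R) :
  (forall i, scalar_ac (g i) a b) ->
  (forall u v, a <= u -> u <= v -> v <= b ->
     `|f v - f u| <= K * \sum_i `|g i v - g i u|) ->
  scalar_ac f a b.
Proof.
move=> gac fg e e0.
pose K1 : R := `|K| + 1; have K10 : 0 < K1 by rewrite ltr_wpDl.
pose N : R := #|I|%:R + 1; have N0 : 0 < N by rewrite ltr_wpDl.
pose e' := e / (K1 * N); have e'0 : 0 < e' by rewrite divr_gt0// mulr_gt0.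
have {gac} /choice[d dP] : forall i, exists d : R, 0 < d /\
  forall (m : nat) (l r : 'I_m -> R),
      (forall i, a <= l i /\ l i <= r i /\ r i <= b) ->
      trivIset setT (fun i => `]l i, r i[%classic) ->
      \sum_i (r i - l i) < d ->
      \sum_j `|g i (r j) - g i (l j)| < e'.
  by move=> i; have [d d0 dP] := gac i _ e'0; exists d.
exists (\big[Order.min/1]_i d i).
  by apply/bigmin_gtP; split => // i _; case: (dP i).
move=> m l r lr tlr /bigmin_gtP[_ lrd].
have {}lrd i : \sum_j `|g i (r j) - g i (l j)| < e'.
  by case: (dP i) => _; apply => //; exact: lrd.
apply: (@le_lt_trans _ _ (\sum_j K1 * \sum_i `|g i (r j) - g i (l j)|)).
  apply: ler_sum => j _; have [al [lrj rb]] := lr j.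
  apply: (le_trans (fg _ _ al lrj rb)).
  by rewrite ler_wpM2r ?sumr_ge0// (le_trans (ler_norm _))// lerDl.
rewrite -mulr_sumr exchange_big/=.
apply: (@le_lt_trans _ _ (K1 * \sum_(i : I) e')).
  by rewrite ler_wpM2l ?(ltW K10)//; apply: ler_sum => i _; exact/ltW/lrd.
rewrite sumr_const -mulr_natr /e' (_ : _ * _ = e * (#|I|%:R / N)); last first.
  by field; rewrite ?gt_eqF.
by rewrite gtr_pMr// ltr_pdivrMr// mul1r ltrDl.
Qed.

Lemma trivIset_chain (R : realType) (m : nat) (l r : nat -> R) :
  (forall i j, (i < j < m)%N -> r i <= l j) ->
  trivIset setT (fun i : 'I_m => `]l i, r i[%classic).
Proof.
move=> lr; apply/trivIsetP => /= i j _ _ ij.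
wlog ltij : i j ij / (i < j)%N => [hw|].
  have [/(hw _ _ ij)//|] := ltnP i j.
  rewrite leq_eqVlt => /orP[/eqP/val_inj ji|/hw]; first by rewrite ji eqxx in ij.
  by rewrite setIC; apply; rewrite eq_sym.
apply/seteqP; split => // x /=; rewrite !in_itv/= => -[/andP[_ xr] /andP[lx _]].
have rl : r i <= l j by apply: lr; rewrite ltij ltn_ord.
by have := lt_trans lx xr; rewrite ltNge rl.
Qed.

Lemma derivable_near (R : realType) (f : R -> R) (s e : R) :
  derivable f s 1 -> 0 < e ->
  \forall y \near s, `|f y - f s - derive1 f s * (y - s)| <= e * `|y - s|.
Proof.
move=> /derivable_nbhs /eqaddoP fs /fs /nbhs_ballP[h /= h0 hP].
apply/nbhs_ballP; exists h => //= y; rewrite /ball/= distrC => ysh.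
have /= := hP (y - s); rewrite /ball/= sub0r normrN => /(_ ysh).
rewrite derive1E /= !fctE/= [X in f (X + s)](mulr1 (y - s)) subrK opprD addrA.
by rewrite [_ *: _]mulrC.
Qed.

(** The exceptional null set lies in an open set U of small measure. Going
    from a to the right, a point outside the null set has a neighbourhood on
    which f grows with slope at most e, and a point of the null set has a
    neighbourhood inside U. The increments of f over disjoint intervals of U
    have a small sum by absolute continuity, so only a small growth is
    possible. *)
Lemma scalar_ac_ae_nonincreasing (R : realType) (f : R -> R) (a b : R) :
  a <= b -> scalar_ac f a b ->
  {ae lebesgue_measure, forall s, a <= s <= b ->
     derivable f s 1 /\ derive1 f s <= 0} ->
  f b <= f a.
Proof.
move=> ab fac [N [mN N0 badN]].
have {}N0 : (@lebesgue_measure R N = 0)%E := N0.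
apply/ler_addgt0Pr => e' e'0.
pose e := e' / (b - a + 1).
have e0 : 0 < e by rewrite divr_gt0// ltr_wpDl ?subr_ge0.
have [d d0 dP] := fac e e0.
have [|U [oU NU UNd]] := @lebesgue_regularity_outer R N d mN _ d0.
  by rewrite [X in (X < _)%E]N0.
have Ud : (lebesgue_measure U < d%:E)%E.
  apply: le_lt_trans UNd; have mU := open_measurable oU.
  have {1}-> : U = N `|` (U `\` N) by rewrite setDUK.
  rewrite (le_trans (measureU2 _ _ _))//; first exact: measurableD.
  by rewrite [X in (X + _ <= _)%E]N0 add0e.
(* S collects the points c such that the growth of f from a to c is paid by
   the slope e and by finitely many ordered intervals of U to the left of c.
   *)
pose S := [set c | a <= c <= b /\ exists m (l r : nat -> R),
   [/\ forall i, (i < m)%N -> [/\ a <= l i, l i <= r i, r i <= c & `]l i, r i[ `<=` U],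
     forall i j, (i < j < m)%N -> r i <= l j &
     f c - f a <= e * (c - a) + \sum_(i < m) `|f (r i) - f (l i)|]].
have Sa : S a.
  split; first by rewrite lexx ab.
  by exists 0%N, (fun=> 0), (fun=> 0); split => //; rewrite big_ord0 !subrr mulr0 addr0.
have Sstep1 c v : S c -> c <= v <= b -> f v - f c <= e * (v - c) -> S v.
  move=> [/andP[ac cb] [m [l [r [H1 H2 H3]]]]] /andP[cv vb] fvc.
  split; first by rewrite (le_trans ac).
  exists m, l, r; split => //; last by lra.
  by move=> i /H1 [*]; split => //; lra.
have Sstep2 c v : S c -> c <= v <= b -> `]c, v[ `<=` U -> S v.
  move=> [/andP[ac cb] [m [l [r [H1 H2 H3]]]]] /andP[cv vb] cvU.
  split; first by rewrite (le_trans ac).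
  pose l' i := if i == m then c else l i.
  pose r' i := if i == m then v else r i.
  exists m.+1, l', r'; split.
  - move=> i; rewrite ltnS leq_eqVlt /l' /r'; have [->//|/= _ /H1[*]] := eqVneq.
    by split => //; lra.
  - move=> i j; rewrite ltnS /l' /r' => /andP[ij jm].
    have im := leq_trans ij jm; rewrite (ltn_eqF im).
    case: eqVneq => [_|jNm]; first by have [] := H1 i im.
    by apply: H2; rewrite ij ltn_neqAle jNm.
  - rewrite big_ord_recr/= /l' /r' eqxx.
    under eq_bigr do rewrite (ltn_eqF (ltn_ord _)).
    have := ler_norm (f v - f c).
    have : e * (c - a) <= e * (v - a) by rewrite ler_pM2l//; lra.
    by lra.
(* Around every s membership in S passes from left to right. *)
have gauge s : a <= s <= b -> exists2 h, 0 < h & forall u v, S u -> s - h < u ->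
    u <= s -> s <= v -> v < s + h -> v <= b -> S v.
  move=> sab; have [Ns|Ns] := pselect (N s).
    have /nbhs_ballP[h /= h0 hU] : nbhs s U by apply: oU; exact: NU.
    exists h => // u v Su su us sv vs vb.
    apply: (Sstep2 u) => //; first by rewrite (le_trans us).
    move=> x /=; rewrite in_itv/= => /andP[ux xv]; apply: hU.
    rewrite /ball/= ltr_norml; lra.
  have [df df0] : derivable f s 1 /\ derive1 f s <= 0.
    by apply: contra_notP Ns => Ns; apply: badN => /= /(_ sab).
  move: (derivable_near df e0) => /nbhs_ballP[h /= h0 hU].
  exists h => // u v Su su us sv vs vb.
  have Ss : S s.
    apply: (Sstep1 u) => //; first by case/andP : sab => _ ->; rewrite us.
    have /hU : ball s h u by rewrite /ball/= ltr_norml; lra.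
    rewrite [`|u - s|]ler0_norm ?subr_le0// ler_norml => /andP[+ _].
    have : 0 <= derive1 f s * (u - s) by rewrite mulr_le0//; lra.
    by lra.
  apply: (Sstep1 s) => //; first by rewrite sv.
  have /hU : ball s h v by rewrite /ball/= ltr_norml; lra.
  rewrite [`|v - s|]ger0_norm ?subr_ge0// ler_norml => /andP[_].
  have : derive1 f s * (v - s) <= 0 by rewrite mulr_le0_ge0//; lra.
  by lra.
have hsS : has_sup S by split; [exists a|exists b => x [/andP[]]].
have aS : a <= sup S by apply: ub_le_sup => //; exact: hsS.2.
have Sb' : sup S <= b by apply: ge_sup; [exact: hsS.1|move=> x [/andP[]]].
have Sb : S b.
  have [h h0 hS] := gauge (sup S) ltac:(by rewrite aS Sb').
  have [u Su uS] := sup_adherent h0 hsS.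
  have us : u <= sup S by apply: ub_le_sup => //; exact: hsS.2.
  have [bh|bh] := ltP b (sup S + h).
    by apply: (hS u b) => //.
  have : S (sup S + h / 2) by apply: (hS u) => //; lra.
  move=> /(ub_le_sup hsS.2); lra.
move: Sb => [_ [m [l [r [H1 H2 H3]]]]].
have : \sum_(i < m) `|f (r i) - f (l i)| < e.
  have lrt := @trivIset_chain R m l r H2.
  apply: dP => //.
    by move=> i; have [] := H1 _ (ltn_ord i).
  rewrite -lte_fin; apply: le_lt_trans Ud.
  have -> : (\sum_(i < m) (r i - l i))%:E =
      (\sum_(i < m) lebesgue_measure `]l i, r i[%classic)%E.
    rewrite -sumEFin; apply: eq_bigr => i _.
    rewrite lebesgue_measure_itv/= lte_fin EFinB.
    by have [_] := H1 i (ltn_ord i); case: ltgtP => // <-; rewrite -EFinB subrr.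
  rewrite -measure_semi_additive_ord//; last first.
    by apply: bigsetU_measurable.
  apply: le_measure; rewrite ?inE//.
  - by apply: bigsetU_measurable.
  - exact: open_measurable.
  - elim/big_ind : _ => // [A B AU BU x [/AU|/BU]//|i _].
    by have [] := H1 i (ltn_ord i).
have : e * (b - a + 1) = e' by rewrite /e divfK// gt_eqF// ltr_wpDl ?subr_ge0.
by lra.
Qed.

Lemma scalar_ac_sub (R : realType) (f : R -> R) (a b c d : R) :
  a <= c -> d <= b -> scalar_ac f a b -> scalar_ac f c d.
Proof.
move=> ac db fac e /fac[h h0 hP]; exists h => // m l r lr; apply: hP => i.
by have [? [? ?]] := lr i; rewrite (le_trans ac)// (le_trans _ db).
Qed.

Lemma scalar_ac_id (R : realType) (a b : R) : scalar_ac id a b.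
Proof.
move=> e e0; exists e => // m l r lr _; apply: le_lt_trans.
rewrite le_eqVlt; apply/orP; left; apply/eqP/eq_bigr => i _.
by rewrite ger0_norm// subr_ge0; have [_ []] := lr i.
Qed.

Lemma scalar_ac_lipschitz (R : realType) (f : R -> R) (a b K : R) :
  (forall u v, a <= u -> u <= v -> v <= b -> `|f v - f u| <= K * (v - u)) ->
  scalar_ac f a b.
Proof.
move=> fK; apply: (@scalar_ac_dominated _ unit (fun=> id) _ _ _ K).
  by move=> _; exact: scalar_ac_id.
move=> u v au uv vb; rewrite big_const card_unit/= addr0 (ger0_norm (x := v - u)).
  exact: fK.
by rewrite subr_ge0.
Qed.

Lemma scalar_acB (R : realType) (f g : R -> R) (a b : R) :
  scalar_ac f a b -> scalar_ac g a b -> scalar_ac (fun s => f s - g s) a b.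
Proof.
move=> fac gac.
apply: (@scalar_ac_dominated _ bool (fun c => if c then f else g) _ _ _ 1).
  by case.
move=> u v _ _ _; rewrite big_bool/= mul1r.
rewrite (_ : _ - _ = (f v - f u) - (g v - g u)); last by ring.
exact: ler_normB.
Qed.

Lemma scalar_acD (R : realType) (f g : R -> R) (a b : R) :
  scalar_ac f a b -> scalar_ac g a b -> scalar_ac (fun s => f s + g s) a b.
Proof.
move=> fac gac.
apply: (@scalar_ac_dominated _ bool (fun c => if c then f else g) _ _ _ 1).
  by case.
move=> u v _ _ _; rewrite big_bool/= mul1r.
rewrite (_ : _ - _ = (f v - f u) + (g v - g u)); last by ring.
exact: ler_normD.
Qed.

Lemma scalar_ac_sum (R : realType) (I : finType) (f : I -> R -> R) (a b : R) :
  (forall i, scalar_ac (f i) a b) -> scalar_ac (fun s => \sum_i f i s) a b.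
Proof.
move=> fac; apply: (@scalar_ac_dominated _ I f _ _ _ 1) => // u v _ _ _.
by rewrite mul1r -sumrB ler_norm_sum.
Qed.

(** The retraction of the line onto the segment from a to b. *)
Definition clamp (R : realType) (a b s : R) : R := Num.max a (Num.min b s).

Lemma clamp_itv (R : realType) (a b s : R) : a <= b -> a <= clamp a b s <= b.
Proof. by move=> ab; rewrite /clamp le_max lexx/= ge_max ab ge_min lexx. Qed.

Lemma clamp_id (R : realType) (a b s : R) : a <= s <= b -> clamp a b s = s.
Proof. by move=> /andP[as_ sb]; rewrite /clamp (min_idPr sb) (max_idPr as_). Qed.

Lemma clamp_lip (R : realType) (a b s t : R) :
  `|clamp a b s - clamp a b t| <= `|s - t|.
Proof.
rewrite /clamp.
have H (x y z : R) : `|Num.max x y - Num.max x z| <= `|y - z|.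
  by case: (leP x y); case: (leP x z) => xz xy; rewrite ?ler_norml ?subrr ?normr0//;
     have := ler_norm (y - z); have := ler_norm (z - y); rewrite (distrC z y); lra.
have H' (x y z : R) : `|Num.min x y - Num.min x z| <= `|y - z|.
  by case: (leP x y); case: (leP x z) => xz xy; rewrite ?ler_norml ?subrr ?normr0//;
     have := ler_norm (y - z); have := ler_norm (z - y); rewrite (distrC z y); lra.
exact: le_trans (H _ _ _) (H' _ _ _).
Qed.

Lemma clamp_continuous (R : realType) (a b : R) : continuous (clamp a b).
Proof.
move=> s; apply/cvgrPdist_le => /= e e0; apply/nbhs_ballP; exists e => //= r.
rewrite /ball/= => /ltW; apply: le_trans; exact: clamp_lip.
Qed.

Lemma scalar_ac_clamp_continuous (R : realType) (f : R -> R) (a b : R) :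
  a <= b -> scalar_ac f a b -> continuous (fun s => f (clamp a b s)).
Proof.
move=> ab fac s; apply/cvgrPdist_lt => /= e e0.
have [d d0 dP] := fac e e0.
apply/nbhs_ballP; exists d => //= s'; rewrite /ball/= => sd.
have {sd} cd := le_lt_trans (clamp_lip a b s s') sd.
have /andP[a1 b1] := clamp_itv s ab; have /andP[a2 b2] := clamp_itv s' ab.
move: (clamp a b s) (clamp a b s') cd a1 b1 a2 b2 => {s s'}.
suff H u v : a <= u -> u <= v -> v <= b -> v - u < d -> `|f v - f u| < e.
  move=> u v; case: (leP u v) => [uv|/ltW vu].
    by rewrite distrC (distrC (f u)) ger0_norm ?subr_ge0// => *; apply: H.
  by rewrite ger0_norm ?subr_ge0// => *; apply: H.
move=> au uv vb vud.
have := dP 1%N (fun=> u) (fun=> v); rewrite !big_ord_recl !big_ord0 !addr0.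
apply => //; apply/trivIsetP => i j _ _; by rewrite !ord1 eqxx.
Qed.

(** Disjoint intervals are shortened by [clamp] and stay disjoint. *)
Lemma scalar_ac_clamp (R : realType) (f : R -> R) (a b c d : R) :
  a <= b -> scalar_ac f a b ->
  scalar_ac (fun s => f (clamp a b s)) c d.
Proof.
move=> ab fac e /fac[h h0 hP]; exists h => // m l r lr tlr lrh.
have lrc i : clamp a b (l i) <= clamp a b (r i).
  have [_ [lri _]] := lr i; rewrite /clamp.
  by rewrite ge_max le_max lexx/= le_max le_min !ge_min lexx/= lri !orbT.
apply: (hP m (fun i => clamp a b (l i)) (fun i => clamp a b (r i))).
- move=> i; have /andP[-> _] := clamp_itv (l i) ab.
  by have /andP[_ ->] := clamp_itv (r i) ab.
- apply/trivIsetP => /= i j _ _ ij.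
  have sub k : `]clamp a b (l k), clamp a b (r k)[%classic `<=` `]l k, r k[%classic.
    move=> x /=; rewrite !in_itv/= /clamp gt_max lt_max lt_min.
    rewrite gt_min => /andP[/andP[ax lx]] /orP[xa|/andP[xb xr]].
      by have := lt_trans ax xa; rewrite ltxx.
    by rewrite xr andbT; case/orP : lx => // bx; have := lt_trans xb bx; rewrite ltxx.
  move/trivIsetP : tlr => /(_ i j Logic.I Logic.I ij) lrij.
  apply/seteqP; split => // x [/sub xi /sub xj].
  by rewrite -lrij; split.
- apply: le_lt_trans lrh; apply: ler_sum => i _.
  have [_ [lri _]] := lr i; have := clamp_lip a b (r i) (l i).
  by rewrite !ger0_norm ?subr_ge0.
Qed.

Lemma continuous_itv_bounded (R : realType) (f : R -> R) (a b : R) :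
  a <= b -> continuous f -> exists2 M, 0 < M & forall s, a <= s <= b -> `|f s| <= M.
Proof.
move=> ab fc; have [|c cab cM] := @EVT_max R (fun s => `|f s|) a b ab.
  apply: continuous_subspaceT => s.
  by apply: (@continuous_comp _ _ _ f (fun x => `|x|)); [exact: fc|exact: norm_continuous].
exists (`|f c| + 1); first by rewrite ltr_wpDl.
move=> s sab; apply: (le_trans (cM s _)); first by rewrite in_itv.
by rewrite lerDl.
Qed.

Lemma scalar_ac_bounded (R : realType) (f : R -> R) (a b : R) :
  a <= b -> scalar_ac f a b ->
  exists2 M, 0 < M & forall s, a <= s <= b -> `|f s| <= M.
Proof.
move=> ab fac.
have [M M0 MP] := continuous_itv_bounded ab (scalar_ac_clamp_continuous ab fac).
by exists M => // s sab; have := MP s sab; rewrite clamp_id.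
Qed.

Lemma scalar_acM (R : realType) (f g : R -> R) (a b : R) : a <= b ->
  scalar_ac f a b -> scalar_ac g a b -> scalar_ac (fun s => f s * g s) a b.
Proof.
move=> ab fac gac.
have [M M0 MP] := scalar_ac_bounded ab fac.
have [N N0 NP] := scalar_ac_bounded ab gac.
apply: (@scalar_ac_dominated _ bool (fun c => if c then f else g) _ _ _ (M + N)).
  by case.
move=> u v au uv vb; rewrite big_bool/=.
rewrite (_ : _ - _ = (f v - f u) * g v + f u * (g v - g u)); last by ring.
apply: (le_trans (ler_normD _ _)); rewrite !normrM mulrDr.
apply: lerD.
  rewrite mulrC ler_wpM2r//; apply: (le_trans (NP v _)); last by lra.
  by rewrite vb (le_trans au).
rewrite ler_wpM2r//; apply: (le_trans (MP u _)); last by lra.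
by rewrite au (le_trans uv).
Qed.

Lemma abs_continuousP (R : realType) n (x : R -> 'rV[R]_n) (a b : R) :
  abs_continuous x a b <-> forall i, scalar_ac (fun s => x s 0 i) a b.
Proof.
split=> [xac i e /xac[d d0 dP]|xac e e0].
  exists d => // m l r lr tlr lrd; apply: le_lt_trans (dP m l r lr tlr lrd).
  apply: ler_sum => j _; apply: le_trans (coord_enorm_le _ i).
  by rewrite !mxE.
have [n0|n_gt0] := eqVneq n 0%N.
  exists 1 => // m l r _ _ _; rewrite big1// => i _.
  subst n; apply/eqP; rewrite eq_le enorm_ge0 andbT.
  by rewrite (le_trans (enorm_le_norm _))// mul0r.
have n0 : (0 : R) < n%:R by rewrite ltr0n lt0n.
have e'0 : 0 < e / n%:R by rewrite divr_gt0.
have {xac} /choice[d dP] : forall i, exists d : R, 0 < d /\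
  forall (m : nat) (l r : 'I_m -> R),
      (forall i, a <= l i /\ l i <= r i /\ r i <= b) ->
      trivIset setT (fun i => `]l i, r i[%classic) ->
      \sum_i (r i - l i) < d ->
      \sum_j `|x (r j) 0 i - x (l j) 0 i| < e / n%:R.
  by move=> i; have [d d0 dP] := xac i _ e'0; exists d.
exists (\big[Order.min/1]_i d i).
  by apply/bigmin_gtP; split => // i _; case: (dP i).
move=> m l r lr tlr /bigmin_gtP[_ lrd].
apply: (@le_lt_trans _ _ (\sum_j \sum_i `|x (r j) 0 i - x (l j) 0 i|)).
  apply: ler_sum => j _; apply: (le_trans (enorm_le_sum _)).
  by apply: ler_sum => i _; rewrite !mxE.
rewrite exchange_big/= (_ : e = \sum_(i < n) (e / n%:R)); last first.
  by rewrite sumr_const card_ord -[_ *+ n]mulr_natr divfK// gt_eqF.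
have i0 : 'I_n by case: (n) n_gt0 => // k _; exact: ord0.
rewrite (bigD1 i0)//= [ltRHS](bigD1 i0)//= ltr_leD//.
  by case: (dP i0) => _; apply => //; exact: lrd.
by apply: ler_sum => i _; apply/ltW; case: (dP i) => _; apply => //; exact: lrd.
Qed.

(** * Mean value inequalities and Gronwall estimates *)

Lemma cvg_mx (R : realType) (T : Type) (F : set_system T) (FF : Filter F) m n
    (u : T -> 'M[R]_(m, n)) (l : 'M[R]_(m, n)) :
  (forall i j, (fun s => u s i j) @ F --> l i j) -> u @ F --> l.
Proof.
move=> ul; apply/cvgrPdist_le => /= e e0.
have : forall ij : 'I_m * 'I_n, \forall s \near F, `|l ij.1 ij.2 - u s ij.1 ij.2| <= e.
  by move=> [i j]; have /cvgrPdist_le := ul i j; exact.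
move=> /filter_forall; apply: filterS => s sP.
by apply: norm_mx_le => [|i j]; [exact: ltW|rewrite !mxE; exact: (sP (i, j))].
Qed.

Lemma continuous_entry (R : realType) (T : topologicalType) m n (u : T -> 'M[R]_(m, n)) i j :
  continuous u -> continuous (fun s => u s i j).
Proof.
move=> uc s; apply: (@continuous_comp _ _ _ u (fun M : 'M[R]_(m, n) => M i j)).
  exact: uc.
exact: coord_continuous.
Qed.

Lemma is_derive_mxP (R : realType) m n (u : R -> 'M[R]_(m, n))
    (du : 'M[R]_(m, n)) (s : R) :
  is_derive s 1 u du <-> forall i j, is_derive s 1 (fun s => u s i j) (du i j).
Proof.
split=> [[du1 du2] i j|H].
  have /derivable_mxP dij := du1; apply: DeriveDef; first exact: dij.
  by rewrite -du2 derive_mx// mxE.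
have du1 : derivable u s 1 by apply/derivable_mxP => i j; have [] := H i j.
apply: DeriveDef => //; rewrite derive_mx//; apply/matrixP => i j; rewrite mxE.
by have [_ ->] := H i j.
Qed.

Lemma is_derive_near_eq (R : realType) (V : normedModType R) (f g : R -> V)
    (s : R) (d : V) :
  (\forall x \near s, f x = g x) -> is_derive s 1 f d -> is_derive s 1 g d.
Proof.
by move=> fg; apply: near_eq_is_derive => //; exact: oner_neq0.
Qed.

Lemma is_derive_expRM (R : realType) (c k t s : R) :
  is_derive s 1 (fun s => c * expR (k * (s - t))) (k * (c * expR (k * (s - t)))).
Proof.
have d1 : is_derive s 1 (fun s => k * (s - t)) (k * 1).
  have -> : (fun s => k * (s - t)) = (fun s => k *: (s - t)) by [].
  have : is_derive s 1 (id - cst t) (1 - 0) by apply: is_deriveB.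
  by rewrite subr0 => H; apply: is_deriveZ.
have d2 : is_derive (k * (s - t)) 1 (@expR R) (expR (k * (s - t))) by exact: is_derive_expR.
have H := @is_derive1_comp R (@expR R) (fun s => k * (s - t)) _ _ _ d2 d1.
have -> : (fun s => c * expR (k * (s - t))) =
  c *: (@expR R \o (fun s => k * (s - t))) by [].
rewrite (_ : k * _ = c *: (expR (k * (s - t)) * (k * 1))); first exact: is_deriveZ.
by rewrite /GRing.scale/=; ring.
Qed.

Lemma continuous_expRM (R : realType) (c k t : R) :
  continuous (fun s => c * expR (k * (s - t))).
Proof.
move=> s; apply/differentiable_continuous/derivable1_diffP.
by have [] := is_derive_expRM c k t s.
Qed.

(** The mean value theorem under two-sided differentiability inside the
    interval only, which is all that arcs and Riccati solutions provide at the
    endpoints. *)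
Lemma le_of_deriv (R : realType) (f df : R -> R) (a b : R) : a <= b ->
  {within `[a, b], continuous f} -> (forall s, a < s < b -> is_derive s 1 f (df s)) ->
  (forall s, a < s < b -> df s <= 0) -> f b <= f a.
Proof.
move=> ab fc fd df0.
have [||c cab E] := @MVT_segment _ f (fun s => if a < s < b then df s else 0) a b ab.
- by move=> s; rewrite in_itv/= => sab; rewrite sab; exact: fd.
- by [].
rewrite -subr_le0 E; case: ifP => [/df0 dc|_]; last by rewrite mul0r.
by rewrite mulr_le0_ge0// subr_ge0.
Qed.

Lemma mvt_dominated (R : realType) (f h df dh : R -> R) (a b : R) : a <= b ->
  {within `[a, b], continuous f} -> {within `[a, b], continuous h} ->
  (forall s, a < s < b -> is_derive s 1 f (df s)) ->
  (forall s, a < s < b -> is_derive s 1 h (dh s)) ->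
  (forall s, a < s < b -> `|df s| <= dh s) ->
  `|f b - f a| <= h b - h a.
Proof.
move=> ab fc hc fd hd dfh; rewrite ler_norml; apply/andP; split.
  suff : - f b - h b <= - f a - h a by lra.
  apply: (@le_of_deriv _ (fun s => - f s - h s) (fun s => - df s - dh s)) => //.
  - by move=> s; apply: cvgB; [apply: cvgN; exact: fc|exact: hc].
  - move=> s sab; have := fd s sab; have := hd s sab => ? ?.
    by apply: is_deriveB.
  - by move=> s /dfh; rewrite ler_norml; lra.
suff : f b - h b <= f a - h a by lra.
apply: (@le_of_deriv _ (fun s => f s - h s) (fun s => df s - dh s)) => //.
- by move=> s; apply: cvgB; [exact: fc|exact: hc].
- move=> s sab; have := fd s sab; have := hd s sab => ? ?.
  by apply: is_deriveB.
- by move=> s /dfh; rewrite ler_norml; lra.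
Qed.

Lemma mvt_dominated_mx (R : realType) m n (f df : R -> 'M[R]_(m, n))
    (h dh : R -> R) (a b : R) : a <= b ->
  continuous f -> continuous h ->
  (forall s, a < s < b -> is_derive s 1 f (df s)) ->
  (forall s, a < s < b -> is_derive s 1 h (dh s)) ->
  (forall s, a < s < b -> `|df s| <= dh s) ->
  `|f b - f a| <= h b - h a.
Proof.
move=> ab fc hc fd hd dfh.
have H i j : `|f b i j - f a i j| <= h b - h a.
  apply: (@mvt_dominated _ (fun s => f s i j) h (fun s => df s i j) dh) => //;
    try by apply: continuous_subspaceT.
  - apply: continuous_subspaceT => s; exact: (continuous_entry fc).
  - by move=> s /fd/is_derive_mxP.
  - by move=> s /dfh; apply: le_trans; exact: coord_norm_le.
apply: norm_mx_le => [|i j]; last by rewrite !mxE.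
have := @mvt_dominated _ (fun=> 0) h (fun=> 0) dh a b ab.
rewrite subrr normr0; apply => //; try by apply: continuous_subspaceT.
- by apply: continuous_subspaceT => s; exact: cvg_cst.
- by move=> s /dfh; exact: le_trans.
Qed.

(** f s * exp (- k (s - a)) is nonincreasing. *)
Lemma gronwall (R : realType) (f df : R -> R) (a b k : R) : a <= b ->
  continuous f -> (forall s, a < s < b -> is_derive s 1 f (df s)) ->
  (forall s, a < s < b -> df s <= k * f s) -> f b <= f a * expR (k * (b - a)).
Proof.
move=> ab fc fd dfk.
have : f b * (1 * expR (- k * (b - a))) <= f a * (1 * expR (- k * (a - a))).
  apply: (@le_of_deriv _ (fun s => f s * (1 * expR (- k * (s - a))))
    (fun s => f s *: (- k * (1 * expR (- k * (s - a)))) + (1 * expR (- k * (s - a))) *: df s)) => //.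
  - by apply: continuous_subspaceT => s; apply: cvgM; [exact: fc|exact: continuous_expRM].
  - move=> s sab; have := fd s sab; have := is_derive_expRM 1 (- k) a s => ? ?.
    by apply: is_deriveM.
  - move=> s sab; have := dfk s sab; rewrite /GRing.scale/= mul1r.
    have := expR_gt0 (- k * (s - a)); set E := expR _ => E0 H.
    rewrite (_ : _ + _ = E * (df s - k * f s)); last by ring.
    by rewrite mulr_ge0_le0 ?(ltW E0)//; lra.
rewrite !mul1r subrr mulr0 expR0 mulr1 => H.
by rewrite mulNr expRN ler_pdivrMr ?expR_gt0 in H.
Qed.

(** f s * exp (k (s - a)) is nondecreasing. *)
Lemma gronwall_backward (R : realType) (f df : R -> R) (a b k : R) : a <= b ->
  continuous f -> (forall s, a < s < b -> is_derive s 1 f (df s)) ->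
  (forall s, a < s < b -> - df s <= k * f s) -> f a <= f b * expR (k * (b - a)).
Proof.
move=> ab fc fd dfk.
have : - (f b * (1 * expR (k * (b - a)))) <= - (f a * (1 * expR (k * (a - a)))).
  apply: (@le_of_deriv _ (fun s => - (f s * (1 * expR (k * (s - a)))))
    (fun s => - (f s *: (k * (1 * expR (k * (s - a)))) + (1 * expR (k * (s - a))) *: df s))) => //.
  - by apply: continuous_subspaceT => s; apply: cvgN; apply: cvgM; [exact: fc|exact: continuous_expRM].
  - move=> s sab; have := fd s sab; have := is_derive_expRM 1 k a s => ? ?.
    by apply: is_deriveN; apply: is_deriveM.
  - move=> s sab; have := dfk s sab; rewrite /GRing.scale/= mul1r.
    have := expR_gt0 (k * (s - a)); set E := expR _ => E0 H.
    rewrite (_ : - _ = E * (- df s - k * f s)); last by ring.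
    by rewrite mulr_ge0_le0 ?(ltW E0)//; lra.
by rewrite !mul1r subrr mulr0 expR0 mulr1 lerN2.
Qed.

Lemma scalar_ac_derive (R : realType) (f df : R -> R) (a b M : R) : a <= b ->
  continuous f -> (forall s, a < s < b -> is_derive s 1 f (df s)) ->
  (forall s, a < s < b -> `|df s| <= M) -> scalar_ac f a b.
Proof.
move=> ab fc fd dfM; apply: (@scalar_ac_lipschitz _ _ _ _ M) => u v au uv vb.
rewrite mulrBr; apply: (@mvt_dominated _ f (fun s => M * s) df (fun=> M)) => //.
- exact: continuous_subspaceT.
- by apply: continuous_subspaceT => s; apply: cvgM; [exact: cvg_cst|exact: cvg_id].
- by move=> s suv; apply: fd; lra.
- move=> s _; have -> : (fun s => M * s) = M *: (id : R -> R) by [].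
  rewrite -[X in is_derive _ _ _ X](mulr1 M).
  by apply: is_deriveZ.
- by move=> s suv; apply: dfM; lra.
Qed.

Lemma ae_impl (R : realType) (P Q : R -> Prop) : (forall s, P s -> Q s) ->
  {ae @lebesgue_measure R, forall s, P s} -> {ae @lebesgue_measure R, forall s, Q s}.
Proof.
move=> PQ [N [mN N0 badN]]; exists N; split => // s /= Qs; apply: badN => /= Ps.
exact/Qs/PQ.
Qed.

Lemma ae_impl2 (R : realType) (P P' Q : R -> Prop) : (forall s, P s -> P' s -> Q s) ->
  {ae @lebesgue_measure R, forall s, P s} -> {ae @lebesgue_measure R, forall s, P' s} ->
  {ae @lebesgue_measure R, forall s, Q s}.
Proof.
move=> PQ HP HP'.
have := @filterI _ _ (ae_filter_ringOfSetsType (@lebesgue_measure R)) _ _ HP HP'.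
by apply: ae_impl => s [Ps P's]; exact: PQ.
Qed.

Lemma ae_neq (R : realType) (c : R) : {ae @lebesgue_measure R, forall s, s != c}.
Proof.
exists [set c]; split; first exact: measurable_set1.
  exact: lebesgue_measure_set1.
by move=> s /= /negP; rewrite negbK => /eqP.
Qed.

(** The exponential weight is Lipschitz on the interval, so that multiplying
    by it preserves absolute continuity and the classical argument goes
    through. *)
Lemma gronwall_ae (R : realType) (f : R -> R) (a b k : R) : a <= b ->
  scalar_ac f a b ->
  {ae lebesgue_measure, forall s, a <= s <= b ->
     derivable f s 1 /\ derive1 f s <= k * f s} ->
  f b <= f a * expR (k * (b - a)).
Proof.
move=> ab fac fk.
have : f b * (1 * expR (- k * (b - a))) <= f a * (1 * expR (- k * (a - a))).
  apply: (@scalar_ac_ae_nonincreasing _ (fun s => f s * (1 * expR (- k * (s - a)))) a b ab).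
    apply: scalar_acM => //.
    have ce := @continuous_expRM R 1 (- k) a.
    have cd : continuous (fun s => - k * (1 * expR (- k * (s - a)))).
      by move=> s; apply: cvgM; [exact: cvg_cst|exact: ce].
    have [M M0 MP] := continuous_itv_bounded ab cd.
    apply: (@scalar_ac_derive _ _ (fun s => - k * (1 * expR (- k * (s - a)))) a b M ab ce).
      by move=> s _; exact: is_derive_expRM.
    by move=> s sab; apply: MP; lra.
  apply: ae_impl fk => s H sab; have {H} [df dfk] := H sab.
  have := derivableP df; have := is_derive_expRM 1 (- k) a s => d1 d2.
  have d3 := is_deriveM d2 d1.
  split; first by have [] := d3.
  rewrite derive1E; have [_ ->] := d3; rewrite /GRing.scale/= mul1r -derive1E.
  have := expR_gt0 (- k * (s - a)); set E := expR _ => E0.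
  rewrite (_ : _ + _ = E * (derive1 f s - k * f s)); last by ring.
  by rewrite mulr_ge0_le0 ?(ltW E0)//; lra.
rewrite !mul1r subrr mulr0 expR0 mulr1 => H.
by rewrite mulNr expRN ler_pdivrMr ?expR_gt0 in H.
Qed.

Lemma is_derive_sum_fin (R : realType) (W : normedModType R) (I : finType) (f : I -> W -> R)
   (df : I -> R) (z v : W) : (forall i, is_derive z v (f i) (df i)) ->
  is_derive z v (fun z => \sum_i f i z) (\sum_i df i).
Proof.
move=> H.
have -> : (fun z => \sum_i f i z) = \sum_i f i by apply/funext => y; rewrite fct_sumE.
elim/big_ind2 : _ => //; first exact: is_derive_cst.
by move=> ? ? ? ? ? ?; exact: is_deriveD.
Qed.

Lemma continuous_sum_fin (R : realType) (T : topologicalType) (I : finType)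
    (f : I -> T -> R) :
  (forall i, continuous (f i)) -> continuous (fun s => \sum_i f i s).
Proof.
move=> fc; have -> : (fun s => \sum_i f i s) = \sum_i f i by apply/funext => y; rewrite fct_sumE.
elim/big_ind : _ => [|g h gc hc|i _]; last exact: fc.
  by move=> s; exact: cvg_cst.
by move=> s; apply: cvgD; [exact: gc|exact: hc].
Qed.

Lemma continuous_bounded_norm (R : realType) (V : normedModType R) (u : R -> V) (a b : R) :
  a <= b -> continuous u -> exists2 M, 0 < M & forall s, a <= s <= b -> `|u s| <= M.
Proof.
move=> ab uc; have [|M M0 MP] := @continuous_itv_bounded R (fun s => `|u s|) a b ab.
  by move=> s; apply: (@continuous_comp _ _ _ u (fun v => `|v|)); [exact: uc|exact: norm_continuous].
by exists M => // s sab; have := MP s sab; rewrite normr_id.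
Qed.

Lemma continuous_mulmx (R : realType) (T : topologicalType) m n k
    (A : T -> 'M[R]_(m, n)) (B : T -> 'M[R]_(n, k)) :
  continuous A -> continuous B -> continuous (fun s => A s *m B s).
Proof.
move=> Ac Bc s; apply: cvg_mx => i j; rewrite mxE.
under eq_fun do rewrite mxE.
apply: (@continuous_sum_fin _ _ _ (fun l s => A s i l * B s l j)) => l r; apply: cvgM.
  by exact: (continuous_entry Ac).
by exact: (continuous_entry Bc).
Qed.

Lemma continuous_trmx (R : realType) (T : topologicalType) m n (A : T -> 'M[R]_(m, n)) :
  continuous A -> continuous (fun s => (A s)^T).
Proof.
move=> Ac s; apply: cvg_mx => i j; rewrite mxE; under eq_fun do rewrite mxE.
by exact: (continuous_entry Ac).
Qed.

Lemma is_derive_mulR (R : realType) (f g : R -> R) (df dg s : R) :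
  is_derive s 1 f df -> is_derive s 1 g dg ->
  is_derive s 1 (fun s => f s * g s) (df * g s + f s * dg).
Proof.
move=> fd gd; rewrite addrC [df * _]mulrC.
by apply: is_deriveM.
Qed.

Lemma is_derive_mulmx (R : realType) m n k (A : R -> 'M[R]_(m, n))
    (B : R -> 'M[R]_(n, k)) dA dB (s : R) :
  is_derive s 1 A dA -> is_derive s 1 B dB ->
  is_derive s 1 (fun s => A s *m B s) (dA *m B s + A s *m dB).
Proof.
move=> /is_derive_mxP Ad /is_derive_mxP Bd; apply/is_derive_mxP => i j.
under eq_fun do rewrite mxE; rewrite !mxE -big_split/=.
by apply: (@is_derive_sum_fin _ _ _ (fun l s => A s i l * B s l j)) => l; exact: is_derive_mulR.
Qed.

Lemma is_derive_dot (R : realType) n (u v : R -> 'rV[R]_n) du dv (s : R) :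
  is_derive s 1 u du -> is_derive s 1 v dv ->
  is_derive s 1 (fun s => dot (u s) (v s)) (dot du (v s) + dot (u s) dv).
Proof.
move=> /is_derive_mxP ud /is_derive_mxP vd; rewrite /dot -big_split/=.
by apply: (@is_derive_sum_fin _ _ _ (fun l s => u s 0 l * v s 0 l)) => l; exact: is_derive_mulR.
Qed.

Lemma continuous_dot (R : realType) n (u v : R -> 'rV[R]_n) :
  continuous u -> continuous v -> continuous (fun s => dot (u s) (v s)).
Proof.
move=> uc vc; apply: continuous_sum_fin => i s; apply: cvgM.
  by exact: (continuous_entry uc).
by exact: (continuous_entry vc).
Qed.

(** The squared Euclidean norm of the entries: unlike the sup norm it is
    differentiable, which is what Gronwall estimates for vectors and matrices
    need. *)
Definition sqn (R : realType) m n (A : 'M[R]_(m, n)) : R := \sum_ij A ij.1 ij.2 ^+ 2.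

Section Sqn.
Context {R : realType} {m n : nat}.
Implicit Types A B : 'M[R]_(m, n).

Lemma sqn_ge0 A : 0 <= sqn A.
Proof. by apply: sumr_ge0 => ij _; rewrite sqr_ge0. Qed.

Lemma norm_sqn A : `|A| ^+ 2 <= sqn A.
Proof.
rewrite -[leRHS]sqr_sqrtr ?sqn_ge0// lerXn2r ?nnegrE ?sqrtr_ge0//.
apply: norm_mx_le => [|i j]; first exact: sqrtr_ge0.
rewrite -sqrtr_sqr ler_sqrt ?sqn_ge0// /sqn (bigD1 (i, j))//= lerDl.
by apply: sumr_ge0 => ij _; rewrite sqr_ge0.
Qed.

Lemma sum_const_card (c : R) : \sum_(ij : 'I_m * 'I_n) c = (m * n)%:R * c.
Proof. by rewrite sumr_const card_prod !card_ord mulr_natl. Qed.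

Lemma sqn_le A : sqn A <= (m * n)%:R * `|A| ^+ 2.
Proof.
rewrite -sum_const_card; apply: ler_sum => -[i j] _.
by rewrite -[leLHS]real_normK ?num_real// lerXn2r ?nnegrE// coord_norm_le.
Qed.

Lemma sqn_pair_le A B :
  `|\sum_ij 2 * (A ij.1 ij.2 * B ij.1 ij.2)| <= 2 * (m * n)%:R * (`|A| * `|B|).
Proof.
rewrite mulrAC mulrC -sum_const_card; apply: (le_trans (ler_norm_sum _ _ _)).
apply: ler_sum => -[i j] _; rewrite normrM ger0_norm// ler_wpM2l// normrM.
by apply: ler_pM => //; exact: coord_norm_le.
Qed.

Lemma sqn_deriv_bound A B (k : R) : 0 <= k -> `|B| <= k * `|A| ->
  `|\sum_ij 2 * (A ij.1 ij.2 * B ij.1 ij.2)| <= 2 * (m * n)%:R * k * sqn A.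
Proof.
move=> k0 Bk; apply: (le_trans (sqn_pair_le A B)).
rewrite -[leRHS]mulrA ler_wpM2l ?mulr_ge0//.
apply: (@le_trans _ _ (`|A| * (k * `|A|))); first by rewrite ler_wpM2l.
by rewrite mulrCA -expr2 ler_wpM2l// norm_sqn.
Qed.

Lemma is_derive_sqn (u : R -> 'M[R]_(m, n)) (du : 'M[R]_(m, n)) (s : R) :
  is_derive s 1 u du ->
  is_derive s 1 (fun s => sqn (u s)) (\sum_ij 2 * (u s ij.1 ij.2 * du ij.1 ij.2)).
Proof.
move=> /is_derive_mxP ud; apply: is_derive_sum_fin => -[i j] /=.
have H := ud i j.
have -> : (fun s => u s i j ^+ 2) = (fun s => u s i j) * (fun s => u s i j).
  by apply/funext => r; rewrite expr2.
rewrite (_ : 2 * _ = u s i j *: du i j + u s i j *: du i j).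
  by apply: is_deriveM.
by rewrite /GRing.scale/=; ring.
Qed.

Lemma continuous_sqn (u : R -> 'M[R]_(m, n)) :
  continuous u -> continuous (fun s => sqn (u s)).
Proof.
move=> uc; apply: continuous_sum_fin => ij s.
have cij : continuous (fun s => u s ij.1 ij.2).
  move=> r; exact: (continuous_entry uc).
have -> : (fun s => u s ij.1 ij.2 ^+ 2) = (fun s => u s ij.1 ij.2 * u s ij.1 ij.2).
  by apply/funext => r; rewrite expr2.
by apply: cvgM; exact: cij.
Qed.

End Sqn.

Lemma scalar_ac_sqn (R : realType) n (x : R -> 'rV[R]_n) (a b : R) : a <= b ->
  abs_continuous x a b -> scalar_ac (fun s => sqn (x s)) a b.
Proof.
move=> ab /abs_continuousP xac; apply: scalar_ac_sum => -[i j] /=; rewrite ord1.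
have -> : (fun s => x s 0 j ^+ 2) = (fun s => x s 0 j * x s 0 j).
  by apply/funext => r; rewrite expr2.
exact: scalar_acM.
Qed.

Lemma derivable_is_derive1 (R : realType) (V : normedModType R) (x : R -> V) (s : R) :
  derivable x s 1 -> is_derive s 1 x (derive1 x s).
Proof. by move=> dx; rewrite derive1E; exact: derivableP. Qed.

Lemma is_derive1E (R : realType) (V : normedModType R) (x : R -> V) (s : R) d :
  is_derive s 1 x d -> derivable x s 1 /\ derive1 x s = d.
Proof. by move=> [? <-]; rewrite derive1E. Qed.

(** * Primitives and ordinary differential equations *)

(** The integral is differentiable to the right of its base point only. Basing
    it at t - 1 gives the derivative on both sides of every s > t; freezing it
    before t makes it continuous on the whole line. *)
Lemma primitive (R : realType) (g : R -> R) (t : R) : continuous g ->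
  exists G : R -> R, [/\ continuous G, forall s, s <= t -> G s = 0 &
    forall s, t < s -> is_derive s 1 G (g s)].
Proof.
move=> gc.
pose I s := (\int[lebesgue_measure]_(x in `[t - 1, s]) g x)%R.
have Id s : t - 1 < s -> is_derive s 1 I (g s).
  move=> ts; have [] := @continuous_FTC1_closed R g (t - 1) s (s + 1) _ _ ts.
  - by rewrite ltrDl.
  - apply: continuous_compact_integrable; first exact: segment_compact.
    exact: continuous_subspaceT.
  - exact: gc.
  by move=> d1 d2; apply: DeriveDef; [exact: d1|rewrite -derive1E d2].
pose G s := I (Num.max t s) - I t.
exists G; split.
- move=> s; apply: cvgB; last exact: cvg_cst.
  apply: (@continuous_comp _ _ _ (Num.max t) I).
    by apply: continuous_max => //; exact: cvg_cst.
  apply/differentiable_continuous/derivable1_diffP.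
  by have [] := Id (Num.max t s) _; rewrite // lt_max ltrBlDr ltrDl ltr01.
- by move=> s st; rewrite /G (max_idPl st) subrr.
- move=> s ts; apply: (@is_derive_near_eq _ _ (I - cst (I t))).
    near=> x; rewrite /G (max_idPr _)//.
    by apply/ltW; near: x; exact: lt_nbhsr.
  have H : is_derive s 1 I (g s) by apply: Id; lra.
  by rewrite -[g s]subr0; apply: is_deriveB.
Unshelve. all: by end_near. Qed.

(** f minus a primitive of h is absolutely continuous with zero derivative
    almost everywhere, hence constant. *)
Lemma scalar_ac_ae_C1 (R : realType) (f h : R -> R) (a b : R) : a <= b -> scalar_ac f a b ->
  continuous h ->
  {ae @lebesgue_measure R, forall s, a <= s <= b -> derivable f s 1 /\ derive1 f s = h s} ->
  forall s, a < s < b -> is_derive s 1 f (h s).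
Proof.
move=> ab fac hc fae.
have [G [Gc G0 Gd]] := primitive a hc.
have [M M0 MP] := continuous_itv_bounded ab hc.
have Gac : scalar_ac G a b.
  apply: (scalar_ac_derive (M := M) ab Gc (df := h)).
    by move=> s /andP[aS _]; exact: Gd.
  by move=> s sab; apply: MP; lra.
have E s : a <= s <= b -> f s = G s + f a.
  move=> /andP[as_ sb].
  have Ga : G a = 0 by exact: G0.
  have fs : scalar_ac f a s by exact: scalar_ac_sub fac.
  have Gs : scalar_ac G a s by exact: scalar_ac_sub Gac.
  have H1 : f s - G s <= f a - G a.
    apply: (@scalar_ac_ae_nonincreasing _ (fun s => f s - G s) a s as_); first exact: scalar_acB.
    apply: ae_impl2 fae (ae_neq a) => r H ra /andP[ar rs].
    have [|df dfh] := H; first by rewrite ar (le_trans rs).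
    have ar' : a < r by rewrite lt_neqAle eq_sym ra.
    have H1 := derivable_is_derive1 df; have H2 := Gd r ar'.
    have H3 : is_derive r 1 (fun s => f s - G s) (derive1 f r - h r) by apply: is_deriveB.
    by have [? ->] := is_derive1E H3; split => //; rewrite dfh subrr.
  have H2 : G s - f s <= G a - f a.
    apply: (@scalar_ac_ae_nonincreasing _ (fun s => G s - f s) a s as_); first exact: scalar_acB.
    apply: ae_impl2 fae (ae_neq a) => r H ra /andP[ar rs].
    have [|df dfh] := H; first by rewrite ar (le_trans rs).
    have ar' : a < r by rewrite lt_neqAle eq_sym ra.
    have H1' := derivable_is_derive1 df; have H2 := Gd r ar'.
    have H3 : is_derive r 1 (fun s => G s - f s) (h r - derive1 f r) by apply: is_deriveB.
    by have [? ->] := is_derive1E H3; split => //; rewrite dfh subrr.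
  by lra.
move=> s sab.
apply: (@is_derive_near_eq _ _ (G + cst (f a))).
  have : nbhs s `]a, b[%classic by apply: near_in_itvoo; rewrite in_itv.
  apply: filterS => r /=; rewrite in_itv/= => rab.
  have rab' : a <= r <= b by lra.
  by rewrite (E r rab').
rewrite -[h s]addr0; have H := Gd s; case/andP : sab => /H ? _.
by apply: is_deriveD.
Qed.

Lemma primitive_mx (R : realType) m n (g : R -> 'M[R]_(m, n)) (t : R) (c : 'M[R]_(m, n)) :
  continuous g ->
  exists G : R -> 'M[R]_(m, n), [/\ continuous G, forall s, s <= t -> G s = c &
    forall s, t < s -> is_derive s 1 G (g s)].
Proof.
move=> gc.
have /choice[G GP] : forall ij : 'I_m * 'I_n, exists G : R -> R,
    [/\ continuous G, forall s, s <= t -> G s = 0 &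
    forall s, t < s -> is_derive s 1 G (g s ij.1 ij.2)].
  move=> [i j]; apply: primitive => s /=.
  exact: (continuous_entry gc).
exists (fun s => \matrix_(i, j) (c i j + G (i, j) s)); split.
- move=> s; apply: cvg_mx => i j.
  under eq_fun do rewrite mxE; rewrite mxE; apply: cvgD; first exact: cvg_cst.
  by have [+ _ _] := GP (i, j); apply.
- move=> s st; apply/matrixP => i j; rewrite mxE.
  by have [_ -> //] := GP (i, j); rewrite addr0.
- move=> s ts; apply/is_derive_mxP => i j; under eq_fun do rewrite mxE.
  have [_ _ /(_ s ts) H] := GP (i, j).
  rewrite -[X in is_derive _ _ _ X]add0r.
  by apply: (@is_deriveD _ _ _ (cst (c i j)) (G (i, j))).
Qed.

(** The sequences v k -+ 2 c / 2^k are monotone and adjacent. *)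
Lemma geometric_cauchy (R : realType) (v : nat -> R) (c : R) :
  (forall k, `|v k.+1 - v k| <= c * 2^-1 ^+ k) ->
  exists l, forall k, `|l - v k| <= 2 * c * 2^-1 ^+ k.
Proof.
move=> vc.
pose lo k := v k - 2 * c * 2^-1 ^+ k; pose hi k := v k + 2 * c * 2^-1 ^+ k.
have e2 k : 2 * c * 2^-1 ^+ k.+1 = c * 2^-1 ^+ k :> R by rewrite exprS; field.
have e1 k : 2 * c * 2^-1 ^+ k = c * 2^-1 ^+ k + c * 2^-1 ^+ k :> R by ring.
have loS k : lo k <= lo k.+1.
  by rewrite /lo e2 e1; have := vc k; rewrite ler_norml; lra.
have hiS k : hi k.+1 <= hi k.
  by rewrite /hi e2 e1; have := vc k; rewrite ler_norml; lra.
have c0 k : 0 <= c * 2^-1 ^+ k by apply: le_trans (vc k).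
have lohi k : lo k <= hi k by rewrite /lo /hi e1; have := c0 k; lra.
have lom : {homo lo : i j / (i <= j)%N >-> i <= j} by apply: homo_leq => //; exact: le_trans.
have him i j : (i <= j)%N -> hi j <= hi i.
  by elim: j => [|j IH]; [rewrite leqn0 => /eqP->|rewrite leq_eqVlt => /orP[/eqP->//|/IH];
    exact: le_trans].
have lohi2 i j : lo i <= hi j.
  have := leq_total i j => /orP[ij|ji].
    exact: le_trans (lom _ _ ij) (lohi j).
  exact: le_trans (lohi i) (him _ _ ji).
pose S := range lo.
have S0 : S !=set0 by exists (lo 0%N), 0%N.
have Sub k : ubound S (hi k) by move=> _ [i _ <-].
exists (sup S) => k.
have H1 : lo k <= sup S by apply: ub_le_sup; [exists (hi 0%N)|exists k].
have H2 : sup S <= hi k by apply: ge_sup.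
by move: H1 H2; rewrite /lo /hi ler_norml; lra.
Qed.

Lemma le_half_pow (R : realType) (x c : R) :
  (forall k, x <= c * 2^-1 ^+ k) -> x <= 0.
Proof.
move=> xc; have := @cvg_geometric R c 2^-1.
rewrite ger0_norm ?invr_ge0//.
have -> : 2^-1 < 1 :> R by lra.
move=> /(_ isT) H; rewrite -(cvg_lim _ H)//.
apply: limr_ge; first by apply/cvg_ex; exists 0.
by near=> k; exact: xc.
Unshelve. all: by end_near. Qed.

(** The Picard operator contracts by one half the sup norm weighted by exp (-
    2 L (s - t)), so the iterates converge geometrically at once on every
    bounded interval, without subdividing it. *)
Lemma picard (R : realType) n (g : R -> 'rV[R]_n -> 'rV[R]_n) (L M t : R) (c : 'rV[R]_n) :
  1 <= L -> 0 <= M ->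
  (forall u, continuous u -> continuous (fun s => g s (u s))) ->
  (forall s u v, `|g s u - g s v| <= L * `|u - v|) ->
  (forall s u, `|g s u| <= M) ->
  exists u, [/\ continuous u, u t = c & forall s, t < s -> is_derive s 1 u (g s (u s))].
Proof.
move=> L1 M0 gc gL gM.
have /choice[Phi PhiP] : forall u : R -> 'rV[R]_n, exists G : R -> 'rV[R]_n, continuous u ->
    [/\ continuous G, forall s, s <= t -> G s = c &
      forall s, t < s -> is_derive s 1 G (g s (u s))].
  move=> u; have [uc|uc] := pselect (continuous u); last by exists (fun=> 0).
  by have [G GP] := primitive_mx t c (gc _ uc); exists G.
have [u [u0 uE]] : exists u : nat -> R -> 'rV[R]_n,
    u 0%N = cst c /\ forall k, u k.+1 = Phi (u k).
  by exists (fun k => iter k Phi (cst c)).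
have uc k : continuous (u k).
  by elim: k => [|k IH]; [rewrite u0 => s; exact: cvg_cst|rewrite uE; have [] := PhiP _ IH].
have ut k s : s <= t -> u k s = c.
  by case: k => [|k] st; rewrite ?u0// uE; have [_ + _] := PhiP _ (uc k); exact.
have ud k s : t < s -> is_derive s 1 (u k.+1) (g s (u k s)).
  by move=> ts; rewrite uE; have [_ _] := PhiP _ (uc k); exact.
pose E s := expR (2 * L * (Num.max t s - t)).
have E0 s : 0 < E s by exact: expR_gt0.
have EE s : t <= s -> E s = expR (2 * L * (s - t)) by move=> ts; rewrite /E (max_idPr ts).
(* One application of the Picard operator halves the weighted distance. *)
have contr (v1 v2 w1 w2 : R -> 'rV[R]_n) (C : R) : 0 <= C ->
    continuous w1 -> continuous w2 -> (forall s, s <= t -> w1 s = w2 s) ->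
    (forall s, t < s -> is_derive s 1 w1 (g s (v1 s))) ->
    (forall s, t < s -> is_derive s 1 w2 (g s (v2 s))) ->
    (forall s, `|v1 s - v2 s| <= C * E s) ->
    forall s, `|w1 s - w2 s| <= C / 2 * E s.
  move=> C0 w1c w2c w12 d1 d2 v12 s.
  have [st|/ltW ts] := leP s t.
    by rewrite w12// subrr normr0 mulr_ge0 ?(ltW (E0 _))// divr_ge0.
  have := @mvt_dominated_mx _ _ _ (fun s => w1 s - w2 s)
    (fun s => g s (v1 s) - g s (v2 s)) (fun s => C / 2 * expR (2 * L * (s - t)))
    (fun s => 2 * L * (C / 2 * expR (2 * L * (s - t)))) t s ts.
  rewrite /= subrr mulr0 expR0 (w12 t)// subrr subr0 -EE// => H.
  apply: (le_trans (H _ _ _ _ _)) => //.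
  - by move=> r; apply: cvgB; [exact: w1c|exact: w2c].
  - exact: continuous_expRM.
  - move=> r /andP[tr _]; have := d1 r tr; have := d2 r tr => ? ?.
    by apply: is_deriveB.
  - by move=> r _; exact: is_derive_expRM.
  - move=> r /andP[tr _]; apply: (le_trans (gL _ _ _)).
    rewrite -EE ?(ltW tr)//.
    rewrite (_ : 2 * L * _ = L * (C * E r)); last by field.
    by rewrite ler_wpM2l//; lra.
  - by rewrite gerBl mulr1 divr_ge0.
have uS k s : `|u k.+1 s - u k s| <= M * E s * 2^-1 ^+ k.
  elim: k s => [|k IH] s; last first.
    rewrite (_ : _ * _ ^+ _ = M * 2^-1 ^+ k / 2 * E s); last by rewrite exprS; ring.
    apply: (contr (u k.+1) (u k)) => //; last 1 first.
    - by move=> r; rewrite mulrAC; exact: IH.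
    - by rewrite mulr_ge0// exprn_ge0// invr_ge0.
    - by move=> r rt; rewrite !ut.
  rewrite expr0 mulr1 [u 0%N s](_ : _ = c); last by rewrite u0.
  have [st|/ltW ts] := leP s t.
    by rewrite !ut// subrr normr0 mulr_ge0 ?(ltW (E0 _)).
  have := @mvt_dominated_mx _ _ _ (u 1%N)
    (fun s => g s (u 0%N s)) (fun s => M * expR (2 * L * (s - t)))
    (fun s => 2 * L * (M * expR (2 * L * (s - t)))) t s ts (uc 1%N).
  rewrite /= subrr mulr0 expR0 (ut 1%N t)// -EE// mulr1 => H.
  apply: (le_trans (H _ _ _ _)) => //.
  - exact: continuous_expRM.
  - by move=> r /andP[tr _]; exact: (ud 0%N).
  - by move=> r _; exact: is_derive_expRM.
  - move=> r /andP[tr _]; apply: (le_trans (gM _ _)).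
    have e1 : 1 <= expR (2 * L * (r - t)).
      by rewrite -[leLHS]expR0 ler_expR mulr_ge0 ?subr_ge0 ?(ltW tr)//; lra.
    rewrite mulrCA -[leLHS]mulr1 ler_wpM2l//.
    rewrite -[leLHS]mulr1; apply: ler_pM => //; lra.
  - by rewrite gerBl.
have /choice[U UP] : forall s, exists l : 'rV[R]_n, forall k,
    `|l - u k s| <= 2 * (M * E s) * 2^-1 ^+ k.
  move=> s.
  have /choice[l lP] : forall i : 'I_n, exists l : R, forall k,
      `|l - u k s 0 i| <= 2 * (M * E s) * 2^-1 ^+ k.
    move=> i; apply: geometric_cauchy => k.
    apply: le_trans (uS k s); have := coord_norm_le (u k.+1 s - u k s) 0 i.
    by rewrite !mxE.
  exists (\row_i l i) => k; apply: norm_mx_le => [|i j].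
    by rewrite !mulr_ge0// ?exprn_ge0 ?invr_ge0 ?(ltW (E0 _)).
  by rewrite !mxE ord1.
have Uc : continuous U.
  move=> s; apply/cvgrPdist_le => /= e e0.
  have [k kP] : exists k, 2 * (M * E (s + 1)) * 2^-1 ^+ k <= e / 3.
    apply: contrapT => /forallNP H.
    have : e / 3 <= 0.
      apply: (@le_half_pow _ _ (2 * (M * E (s + 1)))) => k.
      by have /negP := H k; rewrite -ltNge => /ltW.
    by lra.
  have Emono r : r <= s + 1 -> E r <= E (s + 1).
    move=> rs; rewrite ler_expR ler_wpM2l//; first lra.
    rewrite lerD2r ge_max le_max lexx/= le_max rs orbT//.
  have UE r : r <= s + 1 -> `|U r - u k r| <= e / 3.
    move=> rs; apply: (le_trans (UP r k)); apply: le_trans kP.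
    rewrite ler_wpM2r ?exprn_ge0 ?invr_ge0// ler_wpM2l// ler_wpM2l//.
    exact: Emono.
  have /cvgrPdist_le /(_ (e / 3)) /= := uc k s.
  have -> : 0 < e / 3 by rewrite divr_gt0.
  move=> /(_ isT) H; near=> r.
  have rs : r <= s + 1 by apply/ltW; near: r; apply: lt_nbhsl; rewrite ltrDl.
  rewrite (_ : U s - U r = (U s - u k s) + (u k s - u k r) - (U r - u k r)); last first.
    by rewrite opprB !subrKA.
  apply: (le_trans (ler_normB _ _)).
  have H1 := UE s ltac:(lra); have H2 := UE r rs.
  have H3 : `|u k s - u k r| <= e / 3 by near: r.
  have := ler_normD (U s - u k s) (u k s - u k r); lra.
have [Wc Wt Wd] := PhiP U Uc.
have WU : Phi U = U.
  apply/funext => s; apply/eqP; rewrite -subr_eq0 -normr_le0.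
  apply: (@le_half_pow _ _ (2 * (M * E s))) => k.
  have := contr U (u k) (Phi U) (u k.+1) (2 * M * 2^-1 ^+ k).
  have -> : 0 <= 2 * M * 2^-1 ^+ k by rewrite !mulr_ge0// exprn_ge0// invr_ge0.
  move=> /(_ isT Wc (uc _)) H.
  have {}H : `|Phi U s - u k.+1 s| <= 2 * M * 2^-1 ^+ k / 2 * E s.
    apply: H => //.
    - by move=> r rt; rewrite Wt// ut.
    - by move=> r; apply: (le_trans (UP r k)); rewrite le_eqVlt; apply/orP; left; apply/eqP; ring.
  have := UP s k.+1.
  rewrite (_ : Phi U s - U s = (Phi U s - u k.+1 s) - (U s - u k.+1 s)); last first.
    by rewrite opprB subrKA.
  move=> H'; apply: (le_trans (ler_normB _ _)).
  apply: (le_trans (lerD H H')); rewrite le_eqVlt; apply/orP; left; apply/eqP.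
  by rewrite exprS; field.
exists U; split => //; first by rewrite -WU Wt.
by move=> s ts; rewrite -[X in is_derive _ _ X _]WU; exact: Wd.
Unshelve. all: by end_near. Qed.

(** * Second-order Taylor expansion and symmetry of second derivatives *)

Lemma is_derive_line (R : realType) (W : normedModType R) (f : W -> R) (z h : W) (r d : R) :
  is_derive (z + r *: h) h f d -> is_derive r 1 (fun r => f (z + r *: h)) d.
Proof.
case; rewrite /derivable /derive.
set F := fun s : R => _; set G := (X in is_derive _ _ X _) => c1 c2.
have FG : F = (fun s => s^-1 *: ((G \o shift r) (s *: 1) - G r)).
  apply/funext => s; rewrite /F /G /=; congr (_ *: (f _ - _)).
  by rewrite [s *: 1]mulr1 scalerDl addrCA.
by apply: DeriveDef; rewrite /derivable /derive -FG.
Qed.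

Lemma derive_lincomb (R : realType) (W : normedModType R) (I : finType)
    (b : I -> W) (c : I -> R) (f : W -> R) (z : W) : differentiable f z ->
  'D_(\sum_i c i *: b i) f z = \sum_i c i * 'D_(b i) f z.
Proof.
move=> df; rewrite deriveE// linear_sum; apply: eq_bigr => i _.
by rewrite linearZ deriveE.
Qed.

Lemma derive_dirZ (R : realType) (W : normedModType R) (f : W -> R) (z v : W) (c : R) :
  differentiable f z -> 'D_(c *: v) f z = c * 'D_v f z.
Proof. by move=> df; rewrite !(deriveE _ df) linearZ. Qed.

Lemma mvt_dominated_closed (R : realType) (f h df dh : R -> R) (a b : R) : a <= b ->
  (forall s, a <= s <= b -> is_derive s 1 f (df s)) ->
  (forall s, a <= s <= b -> is_derive s 1 h (dh s)) ->
  (forall s, a <= s <= b -> `|df s| <= dh s) ->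
  `|f b - f a| <= h b - h a.
Proof.
move=> ab fd hd dfh; have sub s : a < s < b -> a <= s <= b by lra.
apply: (mvt_dominated ab _ _ (df := df) (dh := dh)).
- by apply: derivable_within_continuous => s; rewrite in_itv/= => /fd[].
- by apply: derivable_within_continuous => s; rewrite in_itv/= => /hd[].
- by move=> s /sub/fd.
- by move=> s /sub/hd.
- by move=> s /sub/dfh.
Qed.

Lemma is_derive_mulid (R : realType) (k s : R) : is_derive s 1 (fun s => s * k) k.
Proof.
have -> : (fun s => s * k) = (k *: id : R -> R) by apply/funext => r; exact: mulrC.
rewrite -[X in is_derive _ _ _ X](mulr1 k).
by apply: is_deriveZ.
Qed.

Lemma is_derive_half_sqr (R : realType) (k s : R) :
  is_derive s 1 (fun s => s * (s * (2^-1 * k))) (k * s).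
Proof.
have H1 := is_derive_mulid (2^-1 * k) s.
have := is_deriveM (is_derive_id s 1) H1.
rewrite (_ : s *: _ + _ = k * s)//.
by rewrite /GRing.scale/=; field.
Qed.

(** Along the segment from z to z + h the second derivative of f stays close
    to its initial value; integrating twice gives the estimate. Everything is
    expressed in coordinates over a finite family b because second derivatives
    are only known to be continuous for fixed directions. *)
Lemma taylor2 (R : realType) (W : normedModType R) (I : finType) (b : I -> W) (c : I -> R)
    (U : set W) (f : W -> R) (z : W) (e : R) :
  class_C 2 U f -> 0 <= e ->
  (forall r : R, 0 <= r <= 1 -> U (z + r *: \sum_i c i *: b i)) ->
  (forall r : R, 0 <= r <= 1 -> forall i j,
     `|'D_(b j) ('D_(b i) f) (z + r *: \sum_i c i *: b i) - 'D_(b j) ('D_(b i) f) z| <= e) ->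
  `|f (z + \sum_i c i *: b i) - f z - \sum_i c i * 'D_(b i) f z
    - 2^-1 * \sum_i \sum_j c i * c j * 'D_(b j) ('D_(b i) f) z|
  <= e * (\sum_i `|c i|) ^+ 2.
Proof.
set h := \sum_i c i *: b i => -[fd fC] e0 hU De.
set D1 := \sum_i c i * _; set D2 := \sum_i \sum_j _.
pose f1 (r : R) := \sum_i c i * 'D_(b i) f (z + r *: h).
pose f2 (r : R) := \sum_i \sum_j c i * c j * 'D_(b j) ('D_(b i) f) (z + r *: h).
pose K : R := e * (\sum_i `|c i|) ^+ 2.
have f10 : f1 0 = D1 by rewrite /f1 scale0r addr0.
have f20 : f2 0 = D2 by rewrite /f2 scale0r addr0.
have d0 (r : R) : 0 <= r <= 1 -> is_derive r 1 (fun r => f (z + r *: h)) (f1 r).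
  move=> /hU/fd df; apply: is_derive_line; rewrite /f1 -(derive_lincomb b c df).
  exact/derivableP/diff_derivable.
have d1 (r : R) : 0 <= r <= 1 -> is_derive r 1 f1 (f2 r).
  move=> /hU Ur; apply: is_derive_sum_fin => i.
  have [+ _] := fC (b i) => /(_ _ Ur) df.
  have : is_derive r 1 (fun r => 'D_(b i) f (z + r *: h))
      (\sum_j c j * 'D_(b j) ('D_(b i) f) (z + r *: h)).
    apply: (@is_derive_line _ _ ('D_(b i) f)); rewrite -(derive_lincomb b c df).
    exact/derivableP/diff_derivable.
  move=> H.
  rewrite (_ : \sum_j _ = c i *: \sum_j c j * 'D_(b j) ('D_(b i) f) (z + r *: h)); last first.
    by rewrite /GRing.scale/= mulr_sumr; apply: eq_bigr => j _; rewrite mulrA.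
  by apply: is_deriveZ.
have K2 (r : R) : 0 <= r <= 1 -> `|f2 r - f2 0| <= K.
  move=> r01; rewrite f20 -sumrB.
  apply: (le_trans (ler_norm_sum _ _ _)).
  rewrite /K expr2 mulrA mulr_sumr; apply: ler_sum => i _.
  rewrite -sumrB; apply: (le_trans (ler_norm_sum _ _ _)).
  rewrite mulrAC mulr_sumr; apply: ler_sum => j _.
  rewrite -mulrBr normrM normrM mulrC -mulrA.
  rewrite [leRHS](_ : _ = e * (`|c i| * `|c j|)); last by ring.
  apply: ler_wpM2r; last exact: De.
  by apply: mulr_ge0.
clearbody D1 D2.
have K1 (r : R) : 0 <= r <= 1 -> `|f1 r - f1 0 - r * D2| <= K * r.
  move=> /andP[r0 r1].
  have := @mvt_dominated_closed _ (fun r => f1 r - r * D2) (fun r => r * K)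
    (fun r => f2 r - D2) (fun=> K) 0 r r0.
  rewrite /= !mul0r !subr0 => H.
  rewrite (_ : _ - _ - _ = f1 r - r * D2 - f1 0); last by ring.
  rewrite (mulrC K); apply: H.
  - move=> s s0r; have H1 := d1 s ltac:(lra); have H2 := is_derive_mulid D2 s.
    by apply: is_deriveB.
  - by move=> s _; exact: is_derive_mulid.
  - by move=> s s0r; rewrite -f20; apply: K2; lra.
have := @mvt_dominated_closed _ (fun r => f (z + r *: h) - r * D1 - r * (r * (2^-1 * D2)))
   (fun r => r * (r * (2^-1 * K))) (fun r => f1 r - D1 - D2 * r) (fun r => K * r) 0 1 ler01.
rewrite /= !mul0r !subr0 !mul1r scale1r scale0r addr0 => H.
rewrite (_ : _ - _ = f (z + h) - D1 - 2^-1 * D2 - f z); last by ring.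
have K0 : 0 <= K by rewrite /K mulr_ge0// exprn_ge0// sumr_ge0.
apply: (@le_trans _ _ (2^-1 * K)); last by rewrite -/K; lra.
apply: H.
- move=> s s01; have H0 := d0 s s01; have H1 := is_derive_mulid D1 s.
  have H2 := is_derive_half_sqr D2 s.
  by apply: is_deriveB.
- by move=> s _; exact: is_derive_half_sqr.
- by move=> s s01; have := K1 s s01; rewrite f10 (mulrC D2).
Qed.

(** The second difference of f in the directions v and w is estimated by the
    mean value inequality applied first along v, then along w. *)
Lemma schwarz_half (R : realType) (W : normedModType R) (U : set W) (f : W -> R)
    (z v w : W) (e : R) :
  open U -> U z -> class_C 2 U f -> 0 < e ->
  \forall h \near (0 : R)^'+,
   `|f (z + h *: v + h *: w) - f (z + h *: v) - f (z + h *: w) + f z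
     - h ^+ 2 * 'D_w ('D_v f) z| <= e * h ^+ 2.
Proof.
move=> oU Uz [fd fC] e0.
set D := 'D_w ('D_v f).
have [d d0 dP] : exists2 d : R, 0 < d &
    forall y, `|y| < d -> U (z + y) /\ `|D (z + y) - D z| <= e.
  have Dc : {for z, continuous D} by have [_ /(_ w z Uz)] := fC v.
  have /nbhs_ballP[d1 /= d10 H1] : nbhs z U by apply: open_nbhs_nbhs; split.
  move/cvgrPdist_le : Dc => /(_ e e0) /nbhs_ballP[d2 /= d20 H2].
  exists (Order.min d1 d2); first by rewrite lt_min d10.
  move=> y; rewrite lt_min => /andP[y1 y2]; split.
    by apply: H1; rewrite -ball_normE/= opprD addNKr normrN.
  by rewrite distrC; apply: H2; rewrite -ball_normE/= opprD addNKr normrN.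
have [k k0 kP] : exists2 k, 0 < k &
    forall h r1 r2 : R, 0 < h < k -> 0 <= r1 <= 1 -> 0 <= r2 <= 1 ->
    `|r1 *: (h *: v) + r2 *: (h *: w)| < d.
  exists (d / (`|v| + `|w| + 1)).
    by rewrite divr_gt0// ltr_wpDl.
  move=> h r1 r2 /andP[h0]; rewrite ltr_pdivlMr ?ltr_wpDl// => hd r1P r2P.
  apply: le_lt_trans hd; apply: (le_trans (ler_normD _ _)).
  have H (r : R) (x : W) : 0 <= r <= 1 -> `|r *: (h *: x)| <= h * `|x|.
    move=> /andP[r0 r1']; rewrite !normrZ (ger0_norm r0) (gtr0_norm h0).
    by rewrite ler_piMl// mulr_ge0// ltW.
  have := H _ v r1P; have := H _ w r2P; lra.
near=> h.
have hk : 0 < h < k by apply/andP; split; near: h; [exact: nbhs_right_gt|exact: nbhs_right_lt].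
have h0 : 0 < h by case/andP : hk.
pose G (r : R) := f (z + h *: w + r *: (h *: v)) - f (z + r *: (h *: v)).
pose dG (r : R) := h * 'D_v f (z + h *: w + r *: (h *: v)) - h * 'D_v f (z + r *: (h *: v)).
have UP (r1 r2 : R) : 0 <= r1 <= 1 -> 0 <= r2 <= 1 ->
    U (z + (r1 *: (h *: v) + r2 *: (h *: w))) /\
    `|D (z + (r1 *: (h *: v) + r2 *: (h *: w))) - D z| <= e.
  by move=> r1P r2P; apply: dP; exact: kP.
have one01 : (0 : R) <= (1 : R) <= 1 by apply/andP; split; [exact: ler01|exact: lexx].
have zero01 : (0 : R) <= (0 : R) <= 1 by apply/andP; split; [exact: lexx|exact: ler01].
have Uw (r : R) : 0 <= r <= 1 -> U (z + h *: w + r *: (h *: v)).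
  by move=> rP; have [+ _] := UP r 1 rP one01; rewrite scale1r addrA addrAC.
have U0 (r : R) : 0 <= r <= 1 -> U (z + r *: (h *: v)).
  by move=> rP; have [+ _] := UP r 0 rP zero01; rewrite scale0r addr0.
have Dh y : U y -> 'D_(h *: v) f y = h * 'D_v f y.
  by move=> /fd df; exact: derive_dirZ.
have GD (r : R) : 0 <= r <= 1 -> is_derive r 1 G (dG r).
  move=> rP; rewrite /dG -!Dh; [|exact: U0|exact: Uw].
  have H1 : is_derive r 1 (fun r => f (z + h *: w + r *: (h *: v)))
      ('D_(h *: v) f (z + h *: w + r *: (h *: v))).
    by apply: (@is_derive_line _ _ f); apply/derivableP/diff_derivable/fd/Uw.
  have H2 : is_derive r 1 (fun r => f (z + r *: (h *: v))) ('D_(h *: v) f (z + r *: (h *: v))).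
    by apply: (@is_derive_line _ _ f); apply/derivableP/diff_derivable/fd/U0.
  by apply: is_deriveB.
have dGP (r : R) : 0 <= r <= 1 -> `|dG r - h ^+ 2 * D z| <= e * h ^+ 2.
  move=> rP.
  have := @mvt_dominated_closed _
    (fun s => h * 'D_v f (z + r *: (h *: v) + s *: (h *: w)) - s * (h ^+ 2 * D z))
    (fun s => s * (e * h ^+ 2))
    (fun s => h * (h * D (z + r *: (h *: v) + s *: (h *: w))) - h ^+ 2 * D z)
    (fun=> e * h ^+ 2) 0 1 ler01.
  rewrite /= !mul0r !subr0 scale0r addr0 !mul1r scale1r.
  rewrite (_ : _ - _ - _ = dG r - h ^+ 2 * D z); last by rewrite /dG (addrAC z); ring.
  apply.
  - move=> s sP.
    have [Us _] := UP r s rP sP; rewrite addrA in Us.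
    have [dvf _] := fC v.
    have H1 : is_derive s 1 (fun s => 'D_v f (z + r *: (h *: v) + s *: (h *: w)))
       (h * D (z + r *: (h *: v) + s *: (h *: w))).
      apply: (@is_derive_line _ _ ('D_v f)).
      have -> : h * D (z + r *: (h *: v) + s *: (h *: w)) =
         'D_(h *: w) ('D_v f) (z + r *: (h *: v) + s *: (h *: w)).
        by rewrite derive_dirZ//; exact: dvf.
      exact/derivableP/diff_derivable/dvf.
    have H2 := is_derive_mulid (h ^+ 2 * D z) s.
    have H3 : is_derive s 1 (h *: (fun s => 'D_v f (z + r *: (h *: v) + s *: (h *: w))))
      (h *: (h * D (z + r *: (h *: v) + s *: (h *: w)))) by apply: is_deriveZ.
    exact: (is_deriveB H3 H2).
  - by move=> s _; exact: is_derive_mulid.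
  - move=> s sP; have [_] := UP r s rP sP; rewrite addrA => H.
    rewrite mulrA -expr2 -mulrBr normrM ger0_norm ?exprn_ge0// ?(ltW h0)// mulrC.
    by rewrite ler_wpM2r// exprn_ge0// ltW.
have := @mvt_dominated_closed _ (fun s => G s - s * (h ^+ 2 * D z))
    (fun s => s * (e * h ^+ 2)) (fun s => dG s - h ^+ 2 * D z) (fun=> e * h ^+ 2) 0 1 ler01.
rewrite /= !mul0r !subr0 !mul1r /G !scale1r !scale0r !addr0.
rewrite (_ : _ - _ - _ = f (z + h *: v + h *: w) - f (z + h *: v) - f (z + h *: w) + f z -
   h ^+ 2 * D z); last by rewrite (addrAC z); ring.
apply.
- move=> s sP; have H1 := GD s sP; have H2 := is_derive_mulid (h ^+ 2 * D z) s.
  by apply: is_deriveB.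
- by move=> s _; exact: is_derive_mulid.
- exact: dGP.
Unshelve. all: by end_near. Qed.

(** The second difference in [schwarz_half] is symmetric in v and w. *)
Lemma schwarz (R : realType) (W : normedModType R) (U : set W) (f : W -> R) (z v w : W) :
  open U -> U z -> class_C 2 U f -> 'D_w ('D_v f) z = 'D_v ('D_w f) z.
Proof.
move=> oU Uz fC; apply/eqP; rewrite -subr_eq0 -normr_le0.
apply/ler_addgt0Pr => e e0; rewrite add0r.
have e20 : 0 < e / 2 by rewrite divr_gt0.
have A1 := schwarz_half v w oU Uz fC e20.
have A2 := schwarz_half w v oU Uz fC e20.
have : \forall h \near (0 : R)^'+,
    `|'D_w ('D_v f) z - 'D_v ('D_w f) z| * h ^+ 2 <= e * h ^+ 2 /\ 0 < h.
  move: (nbhs_right_gt (0 : R)); apply: filterS3 A1 A2 => h H1 H2 h0.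
  split => //.
  rewrite (addrAC z (h *: w)) in H2.
  have h20 : 0 <= h ^+ 2 by rewrite exprn_ge0// ltW.
  rewrite -[X in _ * X <= _](ger0_norm h20) -normrM.
  move: H1 H2; set A := f (z + h *: v + h *: w); set B := f (z + h *: v).
  set C := f (z + h *: w).
  move: (h ^+ 2) ('D_w ('D_v f) z) ('D_v ('D_w f) z) (f z) A B C => h2 D1 D2 A0 A B C.
  by rewrite !ler_norml => /andP[H1 H1'] /andP[H2 H2']; apply/andP; split; lra.
move=> /filter_ex[h [H h0]].
by rewrite ler_pM2r ?exprn_gt0// in H.
Unshelve. all: by end_near. Qed.

(** * The Hamiltonian as a support function *)

Section Hamiltonian.
Context {R : realType} {n : nat} (F : 'rV[R]_n -> set 'rV[R]_n) (hSH : SH F).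
Implicit Types x p v : 'rV[R]_n.

Lemma hamiltonian_argmax x p :
  exists2 v, F x v & hamiltonian F x p = dot v p.
Proof.
have [/(_ x)[F0 [_ Fc]] _ _] := hSH.
have [|v Fv vmax] := @EVT_max_rV R n (fun v => dot v p) (F x) F0 Fc.
  by apply: continuous_subspaceT; exact: dot_continuous.
exists v; first by rewrite inE in Fv.
apply/eqP; rewrite eq_le; apply/andP; split.
  apply: ge_sup; first by exists (dot v p), v => //; rewrite inE in Fv.
  by move=> _ [w Fw <-]; apply: vmax; rewrite inE.
apply: ub_le_sup; last by exists v => //; rewrite inE in Fv.
by exists (dot v p) => _ [w Fw <-]; apply: vmax; rewrite inE.
Qed.

Lemma hamiltonian_ge x p v : F x v -> dot v p <= hamiltonian F x p.
Proof.
move=> Fv; have [/(_ x)[F0 [_ Fc]] _ _] := hSH.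
have [|w Fw wmax] := @EVT_max_rV R n (fun v => dot v p) (F x) F0 Fc.
  by apply: continuous_subspaceT; exact: dot_continuous.
apply: ub_le_sup; last by exists v.
by exists (dot w p) => _ [v' Fv' <-]; apply: wmax; rewrite inE.
Qed.

Lemma differentiable_min_derive (W : normedModType R) (f : W -> R) (z v : W) :
  differentiable f z -> (forall y, f z <= f y) -> 'D_v f z = 0.
Proof.
move=> df fmin.
have H w : 0 <= 'D_w f z.
  have dw : derivable f z w by exact: diff_derivable.
  have : (fun h => h^-1 *: ((f \o shift z) (h *: w) - f z)) @ (0 : R)^'+ --> 'D_w f z.
    by apply: cvg_dnbhs_at_right; exact: dw.
  move=> /cvg_lim <- //; apply: limr_ge.
    by apply/cvg_ex; exists ('D_w f z); apply: cvg_dnbhs_at_right; exact: dw.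
  near=> h; rewrite /GRing.scale/= mulr_ge0 ?subr_ge0//.
  by rewrite invr_ge0 ltW//; near: h; exact: nbhs_right_gt.
apply/eqP; rewrite eq_le H andbT.
have := H (- v); rewrite -scaleN1r derive_dirZ//; lra.
Unshelve. all: by end_near. Qed.

Lemma derive_dot v p h : 'D_h (fun p => dot v p) p = dot v h.
Proof.
rewrite /derive; apply/cvg_lim => //.
apply: cvg_near_cst; rewrite near_withinE; near=> r => r0.
by rewrite /= dotDr addrK dotZr scalerA mulVf// scale1r.
Unshelve. all: by end_near. Qed.

(** If v maximizes <., p> over F x, then H(x, .) - <v, .> is nonnegative and
    vanishes at p, so its gradient is zero there. *)
Lemma grad_p_argmax x p : differentiable (hamiltonian F x) p ->
  F x (grad (hamiltonian F x) p) /\ dot (grad (hamiltonian F x) p) p = hamiltonian F x p.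
Proof.
move=> dH; have [v Fv vE] := hamiltonian_argmax x p.
suff -> : grad (hamiltonian F x) p = v by [].
apply/rowP => i; rewrite mxE.
have := @differentiable_min_derive _ (fun q => hamiltonian F x q - dot v q) p (delta_mx 0 i).
have dd := differentiable_dot v p.
rewrite deriveB; [|exact: diff_derivable..].
rewrite derive_dot dot_delta => H.
apply/eqP; rewrite -subr_eq0; apply/eqP/H; first exact: differentiableB.
by move=> q; rewrite vE subrr subr_ge0 hamiltonian_ge.
Qed.

End Hamiltonian.

(** * Frechet subgradients and second derivatives of the Hamiltonian *)

Section Frechet.
Context {R : realType} {n : nat}.
Implicit Types (f : 'rV[R]_n -> R) (x p : 'rV[R]_n).

Lemma enorm0 : enorm (0 : 'rV[R]_n) = 0.
Proof. by rewrite /enorm /dot big1 ?sqrtr0// => i _; rewrite mxE mul0r. Qed.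

Lemma enormZ (c : R) x : enorm (c *: x) = `|c| * enorm x.
Proof.
by rewrite /enorm dotZl dotZr mulrA -expr2 sqrtrM ?sqr_ge0// sqrtr_sqr.
Qed.

Lemma enorm_gt0 x : x != 0 -> 0 < enorm x.
Proof.
move=> x0; rewrite lt_neqAle enorm_ge0 andbT; apply: contra x0 => /eqP x0.
by rewrite -normr_le0 x0 norm_enorm_le.
Qed.

Lemma enorm_delta i : enorm (delta_mx 0 i : 'rV[R]_n) = 1.
Proof. by rewrite /enorm dot_delta mxE !eqxx sqrtr1. Qed.

Lemma frechet_lower f x p e : frechet_subdiff f x p -> 0 < e ->
  \forall y \near x, - (e * enorm (y - x)) <= f y - f x - dot p (y - x).
Proof.
rewrite /frechet_subdiff/= limf_einfE => H e0.
have : ((- e)%:E < ereal_sup [set ereal_inf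
    ((fun y => ((f y - f x - dot p (y - x)) / enorm (y - x))%:E) @` V) | V in x^'])%E.
  by apply: lt_le_trans H; rewrite lte_fin oppr_lt0.
move=> /ereal_sup_gt[_ [V xV <-] eV].
move: xV; rewrite /dnbhs/= /within/= near_simpl; apply: filterS => y yV.
have [->|yx] := eqVneq y x.
  by rewrite !subrr enorm0 mulr0 oppr0 -dotNl /dot big1 ?addr0 ?subrr// => i _; rewrite !mxE mulr0.
have y0 : 0 < enorm (y - x) by apply: enorm_gt0; rewrite subr_eq0.
have : ((- e)%:E < ((f y - f x - dot p (y - x)) / enorm (y - x))%:E)%E.
  by apply: (lt_le_trans eV); apply: ereal_inf_lbound; exists y => //; exact: yV.
by rewrite lte_fin ltr_pdivlMr// mulNr => /ltW.
Qed.

Lemma near_line (x v : 'rV[R]_n) (Q : 'rV[R]_n -> Prop) :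
  (\forall y \near x, Q y) -> \forall h \near (0 : R)^'+, Q (h *: v + x).
Proof.
move=> Qx; suff : \forall h \near (0 : R), Q (h *: v + x) by exact: cvg_within.
have : (fun h : R => h *: v + x) @ (0 : R) --> 0 *: v + x.
  by apply: cvgD; [apply: cvgZl|exact: cvg_cst].
by rewrite scale0r add0r; exact.
Qed.

Lemma frechet_grad f x p : differentiable f x -> frechet_subdiff f x p -> p = grad f x.
Proof.
move=> df fp.
have H v : dot p v <= 'D_v f x.
  have dv : derivable f x v by exact: diff_derivable.
  have dr : (fun h => h^-1 *: ((f \o shift x) (h *: v) - f x)) @ (0 : R)^'+ --> 'D_v f x.
    by apply: cvg_dnbhs_at_right; exact: dv.
  apply/ler_addgt0Pr => e e0.
  have ev0 : 0 < e / (enorm v + 1) by rewrite divr_gt0// ltr_wpDl ?enorm_ge0.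
  rewrite -lerBlDr -(cvg_lim _ dr)//; apply: limr_ge; first by apply/cvg_ex; exists ('D_v f x).
  move: (nbhs_right_gt (0 : R)) (near_line v (frechet_lower fp ev0)); apply: filterS2 => h h0.
  rewrite addrK enormZ dotZr (gtr0_norm h0) /GRing.scale/= => K.
  rewrite mulrC ler_pdivlMr//.
  suff : e / (enorm v + 1) * (h * enorm v) <= e * h by lra.
  rewrite mulrCA mulrC ler_wpM2r ?(ltW h0)//.
  rewrite mulrAC ler_pdivrMr ?ltr_wpDl ?enorm_ge0// ler_pM2l// lerDl//.
apply/rowP => i; rewrite mxE; apply/eqP; rewrite eq_le -{1}dot_delta H/=.
have := H (- delta_mx 0 i); rewrite dotNr dot_delta -[- delta_mx 0 i]scaleN1r derive_dirZ//; lra.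
Qed.

(** A subgradient cannot exceed the rate at which f may increase. *)
Lemma frechet_bound f x p (K : R) :
  (\forall y \near x, f y - f x <= K * enorm (y - x)) ->
  frechet_subdiff f x p -> forall i, `|p 0 i| <= K.
Proof.
move=> fK fp i.
have H (v : 'rV[R]_n) : enorm v = 1 -> dot p v <= K.
  move=> v1; apply/ler_addgt0Pr => e e0.
  have : \forall h \near (0 : R)^'+, dot p v <= K + e.
    move: (nbhs_right_gt (0 : R)) (near_line v (frechet_lower fp e0)) (near_line v fK).
    apply: filterS3 => h h0.
    rewrite addrK enormZ v1 mulr1 dotZr (gtr0_norm h0) => H1 H2.
    rewrite -(ler_pM2l h0); lra.
  by move=> /filter_ex[].
have := H _ (enorm_delta i); have := H (- delta_mx 0 i); rewrite dotNr dot_delta.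
rewrite -scaleN1r enormZ enorm_delta normrN1 mulr1 => /(_ erefl) H1 H2.
by rewrite ler_norml; lra.
Qed.

End Frechet.

(** The Lipschitz constant of H(., p) is proportional to |p|: this is what
    prevents a dual arc from vanishing at one time only. *)
Lemma hamiltonian_lipschitz (R : realType) n (F : 'rV[R]_n -> set 'rV[R]_n)
    (hSH : SH F) (x : 'rV[R]_n) :
  exists2 K : set 'rV[R]_n, nbhs x K & exists2 c : R, 0 < c &
  forall y z p, K y -> K z ->
    hamiltonian F z p - hamiltonian F y p <= c * enorm (z - y) * (n%:R * `|p|).
Proof.
have [_ /(_ x)[K xK [c c0 cP]] _] := hSH.
exists K => //; exists c => // y z p Ky Kz.
have [v Fv ->] := hamiltonian_argmax hSH z p.
have [w Fw [u u1 <-]] := cP z y Kz Ky v Fv.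
have Hw := hamiltonian_ge hSH p Fw.
rewrite dotDl dotZl lerBlDr addrC lerD// ler_wpM2l//.
  by rewrite mulr_ge0 ?enorm_ge0// ltW.
apply: (le_trans (ler_norm _)); apply: (le_trans (dot_norm_le _ _)).
rewrite ler_wpM2l// -[leRHS]mul1r ler_wpM2r//.
by apply: (le_trans (norm_enorm_le _)); move: u1; rewrite /eball/= subr0.
Qed.

Section Hess.
Context {R : realType} {n : nat}.
Local Notation V := 'rV[R]_n.

(** Both sides are limits of the same difference quotient. *)
Lemma derive_fst (f : V * V -> R) (u q v : V) :
  'D_v (fun y => f (y, q)) u = 'D_(v, 0) f (u, q).
Proof.
rewrite /derive; set G := (X in lim (X @ _)); set G' := (X in _ = lim (X @ _)).
suff -> : G = G' by [].
apply/funext => h; rewrite /G /G' /=; congr (_ *: (f _ - _)).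
by rewrite [RHS]surjective_pairing/= scaler0 add0r.
Qed.

Lemma derive_snd (f : V * V -> R) (u q v : V) :
  'D_v (fun y => f (u, y)) q = 'D_(0, v) f (u, q).
Proof.
rewrite /derive; set G := (X in lim (X @ _)); set G' := (X in _ = lim (X @ _)).
suff -> : G = G' by [].
apply/funext => h; rewrite /G /G' /=; congr (_ *: (f _ - _)).
by rewrite [RHS]surjective_pairing/= scaler0 add0r.
Qed.

Lemma differentiable_fst (f : V * V -> R) (u q : V) :
  differentiable f (u, q) -> differentiable (fun y => f (y, q)) u.
Proof.
by move=> df; apply: (@differentiable_comp _ _ _ _ (fun y : V => (y, q)) f) => //.
Qed.

Lemma differentiable_snd (f : V * V -> R) (u q : V) :
  differentiable f (u, q) -> differentiable (fun y => f (u, y)) q.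
Proof.
by move=> df; apply: (@differentiable_comp _ _ _ _ (fun y : V => (u, y)) f) => //.
Qed.

Lemma Jac_entry (G : 'I_n -> V -> R) (x : V) (i j : 'I_n) :
  (forall i, differentiable (G i) x) ->
  Jac (fun y => \row_i G i y) x i j = 'D_(delta_mx 0 j) (G i) x.
Proof.
move=> dG.
have drow : differentiable (fun y => \row_i G i y) x.
  have -> : (fun y => \row_i G i y) = \sum_i (fun y => G i y *: (delta_mx 0 i : V)).
    apply/funext => y; rewrite fct_sumE; apply/rowP => k; rewrite mxE summxE.
    rewrite (bigD1 k)//= big1 ?addr0 => [|l lk]; rewrite !mxE !eqxx/= ?mulr1//.
    by rewrite eq_sym (negbTE lk) mulr0.
  apply: differentiable_sum => k; exact: differentiableZl.
rewrite /Jac !mxE -deriveE//.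
rewrite derive_mx; last exact: diff_derivable.
by rewrite mxE; congr (derive _ _ _); apply/funext => y; rewrite mxE.
Qed.

End Hess.

(** The canonical basis of the phase space, indexed by inl for the state and
    by inr for the costate. *)
Definition pair_basis (R : realType) n (i : 'I_n + 'I_n) : 'rV[R]_n * 'rV[R]_n :=
  match i with inl i => (delta_mx 0 i, 0) | inr i => (0, delta_mx 0 i) end.
Arguments pair_basis {R n} i.

Definition pair_coord (R : realType) n (h : 'rV[R]_n * 'rV[R]_n) (i : 'I_n + 'I_n) : R :=
  match i with inl i => h.1 0 i | inr i => h.2 0 i end.

Lemma pair_basisE (R : realType) n (h : 'rV[R]_n * 'rV[R]_n) :
  h = \sum_i pair_coord h i *: pair_basis i.
Proof.
have fstS (I : finType) (G : I -> 'rV[R]_n * 'rV[R]_n) : (\sum_i G i).1 = \sum_i (G i).1.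
  exact: (big_morph fst).
have sndS (I : finType) (G : I -> 'rV[R]_n * 'rV[R]_n) : (\sum_i G i).2 = \sum_i (G i).2.
  exact: (big_morph snd).
rewrite big_sumType/=; case: h => u q; congr (_, _); rewrite /= ?fstS ?sndS/=.
- rewrite [X in _ + X]big1 ?addr0 => [|i _]; last by rewrite scaler0.
  exact: row_sum_delta.
- rewrite [X in X + _]big1 ?add0r => [|i _]; last by rewrite scaler0.
  exact: row_sum_delta.
Qed.

Section HessHamiltonian.
Context {R : realType} {n : nat} (F : 'rV[R]_n -> set 'rV[R]_n) (hC2 : hamiltonian_C2 F).
Local Notation V := 'rV[R]_n.
Local Notation H := (hamiltonian F).
Definition uncurried_hamiltonian (z : V * V) : R := hamiltonian F z.1 z.2.
Local Notation Hu := uncurried_hamiltonian.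
Definition hess_entry (i j : 'I_n + 'I_n) (z : V * V) : R :=
  'D_(pair_basis j) ('D_(pair_basis i) Hu) z.

Lemma grad_xE u q : grad_x H u q = \row_i 'D_(pair_basis (inl i)) Hu (u, q).
Proof. by apply/rowP => i; rewrite !mxE -derive_fst. Qed.

Lemma grad_pE u q : grad_p H u q = \row_i 'D_(pair_basis (inr i)) Hu (u, q).
Proof. by apply/rowP => i; rewrite !mxE -derive_snd. Qed.

Lemma hamiltonian_diff u q : q != 0 -> differentiable Hu (u, q).
Proof. by move=> q0; apply: hC2.1. Qed.

Lemma hamiltonian_diff2 u q v : q != 0 -> differentiable ('D_v Hu) (u, q).
Proof. by move=> q0; apply: (hC2.2 v).1. Qed.

Lemma hess_xxE u q i j : q != 0 -> hess_xx H u q i j = hess_entry (inl i) (inl j) (u, q).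
Proof.
move=> q0; rewrite /hess_xx.
have -> : (grad_x H)^~ q = (fun y => \row_i 'D_(pair_basis (inl i)) Hu (y, q)).
  by apply/funext => y; rewrite grad_xE.
rewrite (@Jac_entry _ _ (fun i y => 'D_(pair_basis (inl i)) Hu (y, q))); first exact: derive_fst.
by move=> k; apply: (@differentiable_fst _ _ ('D_(pair_basis (inl k)) Hu)); exact: hamiltonian_diff2.
Qed.

Lemma hess_pxE u q i j : q != 0 -> hess_px H u q i j = hess_entry (inl i) (inr j) (u, q).
Proof.
move=> q0; rewrite /hess_px.
have -> : grad_x H u = (fun y => \row_i 'D_(pair_basis (inl i)) Hu (u, y)).
  by apply/funext => y; rewrite grad_xE.
rewrite (@Jac_entry _ _ (fun i y => 'D_(pair_basis (inl i)) Hu (u, y))); first exact: derive_snd.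
by move=> k; apply: (@differentiable_snd _ _ ('D_(pair_basis (inl k)) Hu)); exact: hamiltonian_diff2.
Qed.

Lemma hess_xpE u q i j : q != 0 -> hess_xp H u q i j = hess_entry (inr i) (inl j) (u, q).
Proof.
move=> q0; rewrite /hess_xp.
have -> : (grad_p H)^~ q = (fun y => \row_i 'D_(pair_basis (inr i)) Hu (y, q)).
  by apply/funext => y; rewrite grad_pE.
rewrite (@Jac_entry _ _ (fun i y => 'D_(pair_basis (inr i)) Hu (y, q))); first exact: derive_fst.
by move=> k; apply: (@differentiable_fst _ _ ('D_(pair_basis (inr k)) Hu)); exact: hamiltonian_diff2.
Qed.

Lemma hess_ppE u q i j : q != 0 -> hess_pp H u q i j = hess_entry (inr i) (inr j) (u, q).
Proof.
move=> q0; rewrite /hess_pp.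
have -> : grad_p H u = (fun y => \row_i 'D_(pair_basis (inr i)) Hu (u, y)).
  by apply/funext => y; rewrite grad_pE.
rewrite (@Jac_entry _ _ (fun i y => 'D_(pair_basis (inr i)) Hu (u, y))); first exact: derive_snd.
by move=> k; apply: (@differentiable_snd _ _ ('D_(pair_basis (inr k)) Hu)); exact: hamiltonian_diff2.
Qed.

Lemma open_snd_neq0 : open [set z : V * V | z.2 != 0].
Proof.
have -> : [set z : V * V | z.2 != 0] = snd @^-1` (~` [set 0]).
  by apply/seteqP; split => z /=; [move=> /eqP|move/eqP].
apply: open_comp; first by move=> z _; exact: cvg_snd.
apply: closed_openC; apply: accessible_closed_set1.
exact/hausdorff_accessible/norm_hausdorff.
Qed.

Lemma hess_entryC i j u q : q != 0 -> hess_entry i j (u, q) = hess_entry j i (u, q).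
Proof. by move=> q0; apply: (schwarz _ _ open_snd_neq0 _ hC2). Qed.

Lemma hess_entry_continuous i j u q : q != 0 -> {for (u, q), continuous (hess_entry i j)}.
Proof. by move=> q0; apply: (hC2.2 _).2. Qed.

End HessHamiltonian.

(** * Trajectories, the value function and the dual arc *)

Section Trajectories.
Context {R : realType} {n : nat} (F : 'rV[R]_n -> set 'rV[R]_n) (hSH : SH F).
Context (phi : 'rV[R]_n -> R) (hphi : locally_lipschitz phi) (T : R).

Lemma locally_lipschitz_continuous : continuous phi.
Proof.
move=> x; have [U xU [M [Mr MP]]] := hphi x.
pose K := `|M| + 1.
have K0 : 0 < K by rewrite ltr_wpDl.
have {}MP y : U y -> `|phi x - phi y| <= K * `|x - y|.
  move=> Uy; apply: (MP K _ (x, y)) => /=; last by split => //; exact: nbhs_singleton.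
  by rewrite /K (le_lt_trans (real_ler_norm Mr))// ltrDl.
apply/(@cvgrPdist_le _ _ _ (nbhs x) (nbhs_filter x)) => /= e e0.
have H : \forall y \near x, `|x - y| <= e / K.
  apply/nbhs_ballP; exists (e / K); first by rewrite /= divr_gt0.
  by move=> y; rewrite -ball_normE/= => /ltW.
apply: filterS2 xU H => y Uy yx; apply: (le_trans (MP y Uy)).
by rewrite mulrC -ler_pdivlMr.
Qed.

(** By linear growth of F and Gronwall's inequality for 1 + |y|^2 all
    trajectories from y0 end in one compact ball, where phi is bounded below.
    The value is a real infimum, which only has its meaning for sets that are
    bounded below. *)
Lemma reachable_lower_bound (t : R) (y0 : 'rV[R]_n) : t <= T ->
  exists m, forall y, trajectory F T t y0 y -> m <= phi (y T).
Proof.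
move=> tT; have [_ _ [gam gam0 gamP]] := hSH.
pose k : R := 2 * n%:R * gam * (1 + n%:R).
pose B := (1 + sqn y0) * expR (k * (T - t)).
have yB y : trajectory F T t y0 y -> `|y T| <= B.
  move=> [yac yae yt].
  have : 1 + sqn (y T) <= (1 + sqn (y t)) * expR (k * (T - t)).
    apply: (@gronwall_ae _ (fun s => 1 + sqn (y s)) t T k tT).
      apply: (@scalar_ac_dominated _ unit (fun _ s => sqn (y s)) _ _ _ 1).
        by move=> _; exact: scalar_ac_sqn.
      move=> u v _ _ _; rewrite big_const card_unit/= addr0 mul1r.
      by rewrite opprD addrACA subrr add0r.
    apply: ae_impl yae => s H st; have [dy Fy] := H st.
    have d1 := is_derive_sqn (derivable_is_derive1 dy).
    have d2 : is_derive s 1 (cst 1 + (fun s => sqn (y s)))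
       (0 + \sum_ij 2 * (y s ij.1 ij.2 * (derive1 y s) ij.1 ij.2)) by apply: is_deriveD.
    have [d3 ->] := is_derive1E d2; split=> //.
    rewrite add0r; apply: (le_trans (ler_norm _)); apply: (le_trans (sqn_pair_le _ _)).
    have : `|derive1 y s| <= gam * (1 + n%:R * `|y s|).
      apply: (le_trans (norm_enorm_le _)); apply: (le_trans (gamP _ _ Fy)).
      by rewrite ler_wpM2l ?(ltW gam0)// lerD2l enorm_le_norm.
    move=> H1; rewrite mul1n.
    have := norm_sqn (y s); set X := `|y s|; set S := sqn _ => HS.
    have X0 : 0 <= X by exact: normr_ge0.
    apply: (@le_trans _ _ (2 * n%:R * (X * (gam * (1 + n%:R * X))))).
      by rewrite ler_wpM2l ?mulr_ge0// ler_wpM2l.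
    rewrite /k (_ : 2 * n%:R * gam * (1 + n%:R) * (1 + S) =
      2 * n%:R * (gam * ((1 + n%:R) * (1 + S)))); last by ring.
    rewrite ler_wpM2l ?mulr_ge0// mulrCA ler_wpM2l ?(ltW gam0)//.
    have n0 : (0 : R) <= n%:R by [].
    have : X <= 1 + X ^+ 2 by have := sqr_ge0 (X - 1); rewrite sqrrB expr1n mulr1; lra.
    have : n%:R * X ^+ 2 <= n%:R * S by rewrite ler_wpM2l.
    rewrite expr2 in HS *; move=> H2 H3.
    rewrite mulrDr mulr1 mulrCA; lra.
  rewrite yt -/B => H; have := norm_sqn (y T).
  have := sqr_ge0 (`|y T| - 1); rewrite sqrrB expr1n mulr1; have : 0 <= `|y T| by [].
  lra.
have Bc : compact [set v : 'rV[R]_n | `|v| <= B].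
  apply: bounded_closed_compact.
    by exists B; split; [exact: num_real|move=> M BM v /= vB; exact: le_trans vB (ltW BM)].
  apply: (@closed_comp _ _ (fun v : 'rV[R]_n => `|v|) [set r | r <= B]); last exact: closed_le.
  by move=> v _; exact: norm_continuous.
have B0 : [set v : 'rV[R]_n | `|v| <= B] !=set0.
  by exists 0; rewrite /= normr0 mulr_ge0 ?expR_ge0// addr_ge0// sqn_ge0.
have [|c _ cmin] := @EVT_min_rV R n phi _ B0 Bc.
  exact/continuous_subspaceT/locally_lipschitz_continuous.
by exists (phi c) => y /yB yTB; apply: cmin; rewrite inE.
Qed.

Lemma value_le (t : R) (y0 : 'rV[R]_n) y : t <= T -> trajectory F T t y0 y ->
  value F phi T t y0 <= phi (y T).
Proof.
move=> tT yt; apply: ge_inf; last by exists y.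
have [m mP] := reachable_lower_bound y0 tT.
by exists m => _ [w wt <-]; exact: mP.
Qed.

Lemma trajectory_restrict (t0 t : R) x0 x : t0 <= t ->
  trajectory F T t0 x0 x -> trajectory F T t (x t) x.
Proof.
move=> t0t [/abs_continuousP xac xae _]; split => //.
  apply/abs_continuousP => i; exact: scalar_ac_sub (xac i).
by apply: ae_impl xae => s H /andP[ts sT]; apply: H; rewrite sT (le_trans t0t).
Qed.

Lemma trajectory_concat (t0 t : R) x0 x y : t0 <= t -> t <= T ->
  trajectory F T t0 x0 x -> trajectory F T t (x t) y ->
  trajectory F T t0 x0 (fun s => if s <= t then x s else y s).
Proof.
move=> t0t tT [/abs_continuousP xac xae xt0] [/abs_continuousP yac yae yt].
split; last by rewrite t0t.
  apply/abs_continuousP => i.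
  have xac' : scalar_ac (fun s => x s 0 i) t0 t by exact: scalar_ac_sub (xac i).
  apply: (@scalar_ac_dominated _ bool (fun c s => if c then x (clamp t0 t s) 0 i
    else y (clamp t T s) 0 i) _ _ _ 1).
    case.
      exact: (@scalar_ac_clamp R (fun s => x s 0 i)).
    exact: (@scalar_ac_clamp R (fun s => y s 0 i)).
  have E s : t0 <= s <= T -> (if s <= t then x s else y s) 0 i =
      x (clamp t0 t s) 0 i + y (clamp t T s) 0 i - x t 0 i.
    move=> /andP[ts sT]; case: (leP s t) => st.
      rewrite clamp_id ?ts// /clamp (min_idPr sT) (max_idPl st) yt; ring.
    rewrite (@clamp_id _ t T s) ?sT ?(ltW st)//.
    rewrite /clamp (min_idPl (ltW st)) (max_idPr t0t); ring.
  move=> u v au uv vT; rewrite big_bool/= mul1r.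
  rewrite !E; [|lra..].
  rewrite (_ : _ - _ = (x (clamp t0 t v) 0 i - x (clamp t0 t u) 0 i) +
     (y (clamp t T v) 0 i - y (clamp t T u) 0 i)); last by ring.
  exact: ler_normD.
have := ae_impl2 (fun s (Px : t0 <= s <= T -> derivable x s 1 /\ F (x s) (derive1 x s))
    (Py : t <= s <= T -> derivable y s 1 /\ F (y s) (derive1 y s)) => conj Px Py) xae yae.
apply: ae_impl2 (ae_neq t) => s st [Px Py] /andP[t0s sT].
have [slt|tls|/eqP] := ltgtP s t; last by rewrite (negbTE st).
  have [|dx Fx] := Px; first by rewrite t0s.
  have nx : \forall r \near s, x r = (if r <= t then x r else y r).
    near=> r; rewrite ifT//; apply/ltW; near: r; exact: lt_nbhsl.
  have [d1 ->] := is_derive1E (is_derive_near_eq nx (derivable_is_derive1 dx)).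
  by [].
have [|dy Fy] := Py; first by rewrite (ltW tls).
have ny : \forall r \near s, y r = (if r <= t then x r else y r).
  near=> r; rewrite ifF//; apply/negbTE; rewrite -ltNge; near: r; exact: lt_nbhsr.
have [d1 ->] := is_derive1E (is_derive_near_eq ny (derivable_is_derive1 dy)).
by [].
Unshelve. all: by end_near. Qed.

(** The tail of an optimal trajectory is optimal: a better tail could be glued
    to its beginning. *)
Lemma value_on_optimal (t0 t : R) x0 x : t0 <= t -> t <= T ->
  optimal F phi T t0 x0 x -> value F phi T t (x t) = phi (x T).
Proof.
move=> t0t tT [xt xmin].
have xr := trajectory_restrict t0t xt.
apply/eqP; rewrite eq_le value_le//=.
apply: lb_le_inf; first by exists (phi (x T)), x.
move=> _ [y yt <-].
have := xmin _ (trajectory_concat t0t tT xt yt).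
case: (leP T t) => // Tt.
have -> : y T = x T; last by [].
have TE : t = T by apply/eqP; rewrite eq_le tT.
by case: yt => _ _; rewrite TE.
Qed.

(** Let c be the last zero of p before T. Near c the adjoint inclusion gives
    |p'| <= const * |p|, hence p vanishes slightly beyond c by Gronwall's
    inequality. *)
Lemma dual_arc_neq0 (t0 : R) x p : t0 <= T ->
  abs_continuous x t0 T -> dual_arc F phi T t0 x p -> p T != 0 ->
  forall s, t0 <= s <= T -> p s != 0.
Proof.
move=> t0T /abs_continuousP xac [pac pae _] pT s0 s0P; apply: contraNneq pT => ps0.
have cc (z : R -> 'rV[R]_n) : (forall i, scalar_ac (fun s => z s 0 i) t0 T) ->
    continuous (fun s => z (clamp t0 T s)).
  move=> zac s; apply: cvg_mx => i j; rewrite ord1.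
  exact: (scalar_ac_clamp_continuous t0T (zac j)).
have pc := cc p; have {}pc := pc (proj1 (abs_continuousP _ _ _) pac).
have xc := cc x xac.
pose Z := [set s | t0 <= s <= T /\ p s = 0].
have Zs0 : Z s0 by [].
have hsZ : has_sup Z by split; [exists s0|exists T => x' [/andP[]]].
set c := sup Z.
have s0c : s0 <= c by apply: ub_le_sup => //; exact: hsZ.2.
have cT : c <= T by apply: ge_sup; [exact: hsZ.1|move=> x' [/andP[]]].
have ct0 : t0 <= c by case/andP : s0P => H _; exact: le_trans s0c.
have cE : clamp t0 T c = c by rewrite clamp_id// ct0.
have pc0 : p c = 0.
  apply/eqP; rewrite -normr_le0; apply/ler_addgt0Pr => e e0; rewrite add0r.
  have /(@cvgrPdist_le _ _ _ (nbhs c) (nbhs_filter c))/(_ e e0) := pc c.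
  rewrite cE => /nbhs_ballP[h /= h0 hP].
  have [s Zs cs] := sup_adherent h0 hsZ.
  have [sT ps] := Zs.
  have sc : s <= c by apply: ub_le_sup => //; exact: hsZ.2.
  have /hP : ball c h s by rewrite /ball/= ger0_norm ?subr_ge0//; rewrite -/c in cs; lra.
  by rewrite clamp_id// ps subr0.
have [<-|cNT] := eqVneq c T; first by rewrite pc0.
have {cNT}cT' : c < T by rewrite lt_neqAle cNT.
have [K xK [k k0 KP]] := hamiltonian_lipschitz hSH (x c).
have /nbhs_ballP[h /= h0 hK] : nbhs c (fun s => K^° (x (clamp t0 T s))).
  by apply: (xc c); rewrite cE; exact: nbhs_interior.
(* d > c is chosen so that x stays in the Lipschitz neighbourhood of x c up to
   time d; p d = 0 contradicts the choice of c. *)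
pose d := Order.min (c + h / 2) T.
have cd : c < d by rewrite lt_min cT' ltrDl divr_gt0.
have dT : d <= T by rewrite ge_min lexx orbT.
have dh : d <= c + h / 2 by rewrite ge_min lexx.
have pacd : abs_continuous p c d.
  by apply/abs_continuousP => i; apply: (scalar_ac_sub _ _ (proj1 (abs_continuousP _ _ _) pac i)).
pose k2 := 2 * (1 * n)%:R * (k * n%:R).
have : sqn (p d) <= sqn (p c) * expR (k2 * (d - c)).
  apply: (@gronwall_ae _ (fun s => sqn (p s)) c d k2 (ltW cd)).
    exact: scalar_ac_sqn (ltW cd) pacd.
  apply: ae_impl pae => s H /andP[cs sd].
  have sP : t0 <= s <= T by lra.
  have [_ dp _ fp] := H sP.
  have [d1 ->] := is_derive1E (is_derive_sqn (derivable_is_derive1 dp)); split => //.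
  apply: (le_trans (ler_norm _)); apply: sqn_deriv_bound; first by rewrite mulr_ge0// ltW.
  have Kx : K^° (x s).
    have := hK s; rewrite clamp_id//; apply; rewrite /ball/= ler0_norm ?subr_le0//; lra.
  have fK : \forall y \near x s, hamiltonian F y (p s) - hamiltonian F (x s) (p s)
      <= k * n%:R * `|p s| * enorm (y - x s).
    apply: filterS (Kx) => y Ky.
    apply: (le_trans (KP _ _ (p s) (interior_subset Kx) Ky)).
    by rewrite le_eqVlt; apply/orP; left; apply/eqP; ring.
  apply: norm_mx_le => [|i j]; first by rewrite !mulr_ge0// ltW.
  by rewrite ord1; have := frechet_bound fK fp j; rewrite mxE normrN.
rewrite pc0 [X in _ <= X * _](_ : _ = 0); last by rewrite /sqn big1// => i _; rewrite mxE expr0n.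
rewrite mul0r => H.
have pd0 : p d = 0.
  apply/eqP; rewrite -normr_le0.
  have := le_trans (norm_sqn (p d)) H.
  by move=> H'; rewrite -(@ler_pXn2r _ 2)// ?nnegrE// expr0n.
have Zd : Z d by split => //; rewrite dT (le_trans ct0)// ltW.
have : d <= c by apply: ub_le_sup => //; exact: hsZ.2.
by rewrite leNgt cd.
Qed.

End Trajectories.

(** * Symmetry of the Riccati solution *)

(** The Riccati right-hand sides at Q and at its transpose differ by a linear
    expression in Q - Q^T. *)
Lemma riccati_antisymmetric (R : comNzRingType) n (Q X Y Z W : 'M[R]_n) :
  X^T = X -> W^T = W -> Y^T = Z ->
  - ((Y + Q *m W) *m (Q - Q^T) + (Q - Q^T) *m (Z + W *m Q^T)) =
  - (Y *m Q + Q *m Z + Q *m W *m Q + X) - (- (Y *m Q + Q *m Z + Q *m W *m Q + X))^T.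
Proof.
move=> XT WT YZ; have ZY : Z^T = Y by rewrite -YZ trmxK.
rewrite [in RHS]linearN/= !linearD/= !trmx_mul XT WT YZ ZY.
rewrite ?(mulmxDl, mulmxDr, mulmxN, mulNmx, mulmxA).
by apply/matrixP => i j; rewrite !mxE; ring.
Qed.

Local Notation riccati_rate H u q Q :=
  (hess_px H u q *m Q + Q *m hess_xp H u q + Q *m hess_pp H u q *m Q + hess_xx H u q).

Section Riccati.
Context {R : realType} {n : nat} (F : 'rV[R]_n -> set 'rV[R]_n) (hC2 : hamiltonian_C2 F).
Local Notation H := (hamiltonian F).
Context (x p : R -> 'rV[R]_n) (xc : continuous x) (pc : continuous p).
Context (p0 : forall s, p s != 0).

Lemma continuous_pair (T : topologicalType) (u v : T -> 'rV[R]_n) :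
  continuous u -> continuous v -> continuous (fun s => (u s, v s)).
Proof.
move=> uc vc s; apply: (@cvg_pair _ _ _ (nbhs s) (nbhs (u s)) (nbhs (v s))).
  exact: uc.
exact: vc.
Qed.

Lemma hess_entry_path_continuous i j : continuous (fun s => hess_entry F i j (x s, p s)).
Proof.
move=> s; apply: (@continuous_comp _ _ _ (fun s => (x s, p s)) (hess_entry F i j)).
  exact: continuous_pair.
exact: hess_entry_continuous.
Qed.

Lemma grad_path_continuous : continuous (fun s => grad_p H (x s) (p s)) /\
  continuous (fun s => grad_x H (x s) (p s)).
Proof.
have D v : continuous (fun s => 'D_v (uncurried_hamiltonian F) (x s, p s)).
  move=> s; apply: (@continuous_comp _ _ _ (fun s => (x s, p s)) ('D_v (uncurried_hamiltonian F))).
    exact: continuous_pair.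
  by apply: differentiable_continuous; exact: hamiltonian_diff2.
split=> s; apply: cvg_mx => i j.
  rewrite grad_pE mxE; under eq_fun do rewrite grad_pE mxE.
  exact: D.
rewrite grad_xE mxE; under eq_fun do rewrite grad_xE mxE.
exact: D.
Qed.

Lemma hess_path_continuous :
  [/\ continuous (fun s => hess_xx H (x s) (p s)),
      continuous (fun s => hess_px H (x s) (p s)),
      continuous (fun s => hess_xp H (x s) (p s)) &
      continuous (fun s => hess_pp H (x s) (p s))].
Proof.
split=> s; apply: cvg_mx => i j.
- have E : (fun s => hess_xx H (x s) (p s) i j) = _ := funext (fun s => hess_xxE hC2 (x s) i j (p0 s)).
  suff : continuous (fun s => hess_xx H (x s) (p s) i j) by exact.
  by rewrite E; exact: hess_entry_path_continuous.
- have E : (fun s => hess_px H (x s) (p s) i j) = _ := funext (fun s => hess_pxE hC2 (x s) i j (p0 s)).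
  suff : continuous (fun s => hess_px H (x s) (p s) i j) by exact.
  by rewrite E; exact: hess_entry_path_continuous.
- have E : (fun s => hess_xp H (x s) (p s) i j) = _ := funext (fun s => hess_xpE hC2 (x s) i j (p0 s)).
  suff : continuous (fun s => hess_xp H (x s) (p s) i j) by exact.
  by rewrite E; exact: hess_entry_path_continuous.
- have E : (fun s => hess_pp H (x s) (p s) i j) = _ := funext (fun s => hess_ppE hC2 (x s) i j (p0 s)).
  suff : continuous (fun s => hess_pp H (x s) (p s) i j) by exact.
  by rewrite E; exact: hess_entry_path_continuous.
Qed.

Lemma hess_tr s : [/\ (hess_xx H (x s) (p s))^T = hess_xx H (x s) (p s),
  (hess_pp H (x s) (p s))^T = hess_pp H (x s) (p s) &
  (hess_px H (x s) (p s))^T = hess_xp H (x s) (p s)].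
Proof.
split; apply/matrixP => i j; rewrite mxE.
- exact: (etrans (hess_xxE hC2 (x s) j i (p0 s))
    (etrans (hess_entryC hC2 _ _ (x s) (p0 s)) (esym (hess_xxE hC2 (x s) i j (p0 s))))).
- exact: (etrans (hess_ppE hC2 (x s) j i (p0 s))
    (etrans (hess_entryC hC2 _ _ (x s) (p0 s)) (esym (hess_ppE hC2 (x s) i j (p0 s))))).
- exact: (etrans (hess_pxE hC2 (x s) j i (p0 s))
    (etrans (hess_entryC hC2 _ _ (x s) (p0 s)) (esym (hess_xpE hC2 (x s) i j (p0 s))))).
Qed.

(** P - P^T solves a linear equation by [riccati_antisymmetric] and vanishes
    at T, so it vanishes before T by Gronwall's inequality run backwards. *)
Lemma riccati_symmetric (P : R -> 'M[R]_n) (a T : R) : a <= T -> continuous P ->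
  (forall s, a < s < T -> is_derive s 1 P
    (- riccati_rate H (x s) (p s) (P s))) ->
  (P T)^T = P T -> forall s, a <= s <= T -> (P s)^T = P s.
Proof.
move=> aT Pc Pd PT.
have [cxx cpx cxp cpp] := hess_path_continuous.
pose E s := P s - (P s)^T.
have Ec : continuous E by move=> s; apply: cvgB; [exact: Pc|exact: (continuous_trmx Pc)].
pose A s := hess_px H (x s) (p s) + P s *m hess_pp H (x s) (p s).
pose B s := hess_xp H (x s) (p s) + hess_pp H (x s) (p s) *m (P s)^T.
have Ac : continuous A by move=> s; apply: cvgD; [exact: cpx|exact: (continuous_mulmx Pc cpp)].
have Bc : continuous B.
  by move=> s; apply: cvgD; [exact: cxp|exact: (continuous_mulmx cpp (continuous_trmx Pc))].
have Ed s : a < s < T -> is_derive s 1 E (- (A s *m E s + E s *m B s)).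
  move=> sab; have P1 := Pd s sab; have [xxT ppT pxT] := hess_tr s.
  have P2 : is_derive s 1 (fun s => (P s)^T) (- riccati_rate H (x s) (p s) (P s))^T.
    apply/is_derive_mxP => i j; rewrite mxE; under eq_fun do rewrite mxE.
    by move/is_derive_mxP : P1.
  have P3 := is_deriveB P1 P2.
  by rewrite (riccati_antisymmetric (P s) xxT ppT pxT).
have [MA MA0 MAP] := continuous_bounded_norm aT Ac.
have [MB MB0 MBP] := continuous_bounded_norm aT Bc.
pose k := n%:R * (MA + MB).
pose k2 := 2 * (n * n)%:R * k.
have k0 : 0 <= k by rewrite mulr_ge0// addr_ge0// ltW.
have ET : sqn (E T) = 0.
  by rewrite /E PT subrr /sqn big1// => i _; rewrite mxE expr0n.
move=> s /andP[as_ sT].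
have : sqn (E s) <= sqn (E T) * expR (k2 * (T - s)).
  apply: (@gronwall_backward _ (fun s => sqn (E s))
    (fun s => \sum_ij 2 * (E s ij.1 ij.2 * (- (A s *m E s + E s *m B s)) ij.1 ij.2)) s T k2 sT).
  - exact: continuous_sqn.
  - by move=> r rsT; apply: is_derive_sqn; apply: Ed; lra.
  - move=> r /andP[sr rT]; have rab : a <= r <= T by lra.
    apply: le_trans (ler_norm _) _; rewrite normrN; apply: sqn_deriv_bound => //.
    rewrite normrN; apply: (le_trans (ler_normD _ _)).
    rewrite /k mulrDr mulrDl; apply: lerD; apply: (le_trans (mulmx_norm_le _ _)).
      by rewrite -mulrA ler_wpM2l// ler_wpM2r//; exact: MAP.
    by rewrite -mulrA ler_wpM2l// mulrC ler_wpM2r//; exact: MBP.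
rewrite ET mul0r => Es.
have E0 : E s = 0.
  apply/eqP; rewrite -normr_le0 -(@ler_pXn2r _ 2)// ?nnegrE// expr0n.
  exact: le_trans (norm_sqn _) Es.
by apply/esym/eqP; rewrite -subr_eq0 -/(E s) E0.
Qed.

End Riccati.

(** * Uniform estimates along the optimal arc *)

(** Compactness of the time interval turns a neighbourhood of radius depending
    on s into a uniform one. *)
Lemma segment_tube (R : realType) (W : normedModType R) (a b : R) (Q : R -> W -> Prop) :
  (forall s, a <= s <= b -> \forall r \near s & h \near (0 : W), Q r h) ->
  exists2 eta : R, 0 < eta & forall s h, a <= s <= b -> `|h| < eta -> Q s h.
Proof.
move=> QP.
have /compact_near_coveringP H := @segment_compact R a b.
have {}QP s : `[a, b]%classic s -> \forall r \near s & h \near (0 : W), Q r h.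
  by rewrite /= in_itv/=; exact: QP.
have := H W (nbhs (0 : W)) (fun h s => Q s h) (nbhs_filter _) QP.
rewrite near_simpl => /(@nbhs_ballP _ _ (0 : W))[eta /= eta0 etaP].
exists eta => // s h sab hn; apply: etaP; last by rewrite /= in_itv.
by rewrite -ball_normE/= sub0r normrN.
Qed.

Lemma ler_dist_half (R : realType) (c u v e : R) :
  `|c - u| <= e / 2 -> `|c - v| <= e / 2 -> `|v - u| <= e.
Proof.
move=> cu cv; rewrite (_ : v - u = (c - u) - (c - v)); last by ring.
by apply: (le_trans (ler_normB _ _)); lra.
Qed.

Section Tubes.
Context {R : realType} {W : normedModType R} (a b : R) (z : R -> W) (zc : continuous z).

Let path_cvg s : (fun rh : R * W => z rh.1) @ (s, 0 : W) --> z s.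
Proof. by apply: (@cvg_comp _ _ _ fst z _ (nbhs s)); [exact: cvg_fst|exact: zc]. Qed.

Let shift_cvg s : (fun rh : R * W => z rh.1 + rh.2) @ (s, 0 : W) --> z s.
Proof.
by rewrite -[X in _ --> X]addr0; apply: cvgD; [exact: path_cvg|exact: cvg_snd].
Qed.

Lemma open_tube (U : set W) : open U -> (forall s, a <= s <= b -> U (z s)) ->
  exists2 eta : R, 0 < eta & forall s h, a <= s <= b -> `|h| < eta -> U (z s + h).
Proof.
move=> oU Uz; apply: segment_tube => s /Uz Us.
by apply: (@shift_cvg s U); apply: open_nbhs_nbhs.
Qed.

Lemma continuous_tube (I : finType) (f : I -> W -> R) :
  (forall i s, a <= s <= b -> {for z s, continuous (f i)}) ->
  forall e, 0 < e -> exists2 eta : R, 0 < eta &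
    forall i s h, a <= s <= b -> `|h| < eta -> `|f i (z s + h) - f i (z s)| <= e.
Proof.
move=> fc e e0.
suff [eta eta0 H] : exists2 eta : R, 0 < eta &
    forall s h, a <= s <= b -> `|h| < eta -> forall i, `|f i (z s + h) - f i (z s)| <= e.
  by exists eta => // i s h sab hn; exact: H.
apply: segment_tube => s sab.
apply: (@filter_forall _ _ _ (nbhs (s, 0 : W)) (nbhs_filter _)) => i.
have e20 : 0 < e / 2 by rewrite divr_gt0.
have /(@cvgrPdist_le _ _ _ (nbhs (z s)) (nbhs_filter (z s)))/(_ _ e20) K := fc i s sab.
have K1 := shift_cvg K; have K2 := path_cvg K.
apply: (@filterS2 _ (nbhs (s, 0 : W)) (nbhs_filter _) _ _ _ _ K1 K2) => rh k1 k2.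
exact: (ler_dist_half k2 k1).
Qed.

End Tubes.

Section PairNorm.
Context {R : realType} {n : nat}.
Local Notation V := 'rV[R]_n.

Lemma pair_coord_le (h : V * V) i : `|pair_coord h i| <= `|h|.
Proof.
rewrite prod_normE le_max; case: i => i /=; first by rewrite coord_norm_le.
by rewrite coord_norm_le orbT.
Qed.

Lemma sum_pair_coord_le (h : V * V) : \sum_i `|pair_coord h i| <= (n + n)%:R * `|h|.
Proof.
apply: (@le_trans _ _ (\sum_(i : 'I_n + 'I_n) `|h|)).
  by apply: ler_sum => i _; exact: pair_coord_le.
by rewrite sumr_const card_sum card_ord mulr_natl.
Qed.

End PairNorm.

(** Truncation of a displacement in each coordinate; it makes the feedback
    globally Lipschitz and bounded without changing it near zero. *)
Definition clamp_row (R : realType) n (r : R) (v : 'rV[R]_n) : 'rV[R]_n :=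
  \row_i clamp (- r) r (v 0 i).

Section ClampRow.
Context {R : realType} {n : nat} (r : R) (r0 : 0 <= r).
Implicit Types u v : 'rV[R]_n.

Lemma clamp_row_le v : `|clamp_row r v| <= r.
Proof.
apply: norm_mx_le => // i j; rewrite mxE.
have rr : - r <= r by move: r0 => r0'; lra.
by rewrite ler_norml clamp_itv.
Qed.

Lemma clamp_row_id v : `|v| <= r -> clamp_row r v = v.
Proof.
move=> vr; apply/rowP => i; rewrite mxE clamp_id//.
by rewrite -ler_norml (le_trans _ vr)// coord_norm_le.
Qed.

Lemma clamp_row_lip u v : `|clamp_row r u - clamp_row r v| <= `|u - v|.
Proof.
apply: norm_mx_le => // i j; rewrite !mxE; apply: (le_trans (clamp_lip _ _ _ _)).
by have := coord_norm_le (u - v) 0 j; rewrite !mxE.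
Qed.

Lemma clamp_row_norm_le v : `|clamp_row r v| <= `|v|.
Proof.
have := clamp_row_lip v 0.
by rewrite (@clamp_row_id 0) ?normr0// !subr0.
Qed.

Lemma clamp_row_continuous : continuous (@clamp_row R n r).
Proof.
move=> v; apply: (@cvg_mx R _ (nbhs v) (nbhs_filter v)) => i j; rewrite mxE.
under eq_fun do rewrite mxE.
apply: (@continuous_comp _ _ _ (fun v : 'rV[R]_n => v 0 j) (clamp (- r) r)).
  exact: coord_continuous.
exact: clamp_continuous.
Qed.

End ClampRow.

Section AlongArc.
Context {R : realType} {n : nat} (F : 'rV[R]_n -> set 'rV[R]_n).
Context (hC2 : hamiltonian_C2 F).
Local Notation H := (hamiltonian F).
Local Notation V := 'rV[R]_n.
Context (a T : R) (aT : a <= T) (x p : R -> V).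
Context (xc : continuous x) (pc : continuous p) (p0 : forall s, p s != 0).
Context (xcl : forall s, x (clamp a T s) = x s) (pcl : forall s, p (clamp a T s) = p s).
Local Notation z s := (x s, p s).

Lemma hess_tube (e : R) : 0 < e ->
  exists2 eta : R, 0 < eta & forall s (h : V * V), `|h| < eta ->
    (z s + h).2 != 0 /\ forall i j, `|hess_entry F i j (z s + h) - hess_entry F i j (z s)| <= e.
Proof.
move=> e0; have zc := continuous_pair xc pc.
have [eta1 eta10 H1] := @open_tube R (V * V)%type a T (fun s => z s) zc _ (@open_snd_neq0 R n)
  (fun s _ => p0 s).
have [eta2 eta20 H2] := @continuous_tube R (V * V)%type a T (fun s => z s) zc
  (('I_n + 'I_n) * ('I_n + 'I_n))%type (fun ij => hess_entry F ij.1 ij.2)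
  (fun ij s _ => @hess_entry_continuous R n F hC2 ij.1 ij.2 (x s) (p s) (p0 s)) e e0.
exists (Order.min eta1 eta2); first by rewrite lt_min eta10.
move=> s h; rewrite lt_min => /andP[h1 h2].
have sP := clamp_itv s aT.
split; first by have := H1 _ _ sP h1; rewrite xcl pcl.
by move=> i j; have := H2 (i, j) _ _ sP h2; rewrite xcl pcl.
Qed.

Lemma hess_bound : exists2 B : R, 0 < B & forall s i j, `|hess_entry F i j (z s)| <= B.
Proof.
have /choice[B BP] : forall ij : ('I_n + 'I_n) * ('I_n + 'I_n), exists B : R, 0 < B /\
    forall s, a <= s <= T -> `|hess_entry F ij.1 ij.2 (z s)| <= B.
  move=> ij; have := continuous_itv_bounded aT
    (@hess_entry_path_continuous R n F hC2 x p xc pc p0 ij.1 ij.2).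
  by case=> B B0 BP; exists B.
have B0 ij : 0 <= B ij by have [/ltW] := BP ij.
exists (1 + \sum_ij B ij); first by rewrite ltr_wpDr// sumr_ge0.
move=> s i j; have [_ /(_ (clamp a T s) (clamp_itv s aT))] := BP (i, j).
rewrite xcl pcl => /le_trans; apply.
by rewrite (bigD1 (i, j))//= addrCA lerDl addr_ge0// sumr_ge0.
Qed.

(** The segment between the two perturbed points stays in the tube, where the
    second derivatives are bounded by B. *)
Lemma gradp_lipschitz (eta B : R) (s : R) (h1 h2 : V * V) :
  (forall h : V * V, `|h| < eta ->
     (z s + h).2 != 0 /\ forall i j, `|hess_entry F i j (z s + h)| <= B) ->
  `|h1| < eta -> `|h2| < eta ->
  `|grad_p H (z s + h1).1 (z s + h1).2 - grad_p H (z s + h2).1 (z s + h2).2|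
  <= B * (n + n)%:R * `|h1 - h2|.
Proof.
move=> hP h1e h2e.
have eta0 : 0 < eta by apply: le_lt_trans h1e.
have B0 : 0 <= B -> 0 <= B * (n + n)%:R * `|h1 - h2| by move=> B0; rewrite !mulr_ge0.
have conv (r : R) : 0 <= r <= 1 -> `|h2 + r *: (h1 - h2)| < eta.
  move=> /andP[r0 r1].
  rewrite (_ : _ + _ = r *: h1 + (1 - r) *: h2); last first.
    by rewrite scalerBr scalerBl scale1r addrCA.
  apply: (le_lt_trans (ler_normD _ _)); rewrite !normrZ (ger0_norm r0) ger0_norm ?subr_ge0//.
  have [r00|rp] := eqVneq r 0; first by rewrite r00 mul0r add0r subr0 mul1r.
  have rp' : 0 < r by rewrite lt_neqAle eq_sym rp.
  have : r * `|h1| < r * eta by rewrite ltr_pM2l.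
  have : (1 - r) * `|h2| <= (1 - r) * eta by rewrite ler_wpM2l ?subr_ge0// ltW.
  lra.
have entry i : `|'D_(pair_basis (inr i)) (uncurried_hamiltonian F) (z s + h1) -
    'D_(pair_basis (inr i)) (uncurried_hamiltonian F) (z s + h2)| <= B * (n + n)%:R * `|h1 - h2|.
  set D := 'D_(pair_basis (inr i)) (uncurried_hamiltonian F).
  pose K : R := B * (n + n)%:R * `|h1 - h2|.
  have Dd (w : V * V) : w.2 != 0 -> differentiable D w.
    by case: w => u q /= q0; exact: (hamiltonian_diff2 hC2).
  have := @mvt_dominated_closed R (fun r => D (z s + h2 + r *: (h1 - h2))) (fun r => r * K)
    (fun r => \sum_j pair_coord (h1 - h2) j * 'D_(pair_basis j) D (z s + h2 + r *: (h1 - h2)))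
    (fun=> K) 0 1 ler01.
  rewrite /= scale1r scale0r addr0 mul1r mul0r subr0.
  have -> : z s + h2 + (h1 - h2) = z s + h1 by rewrite -addrA addrC (addrC h2) subrK addrC.
  apply.
  - move=> r rP; apply: (@is_derive_line _ _ D).
    have [q0 _] := hP _ (conv r rP); rewrite addrA in q0.
    have dD := Dd _ q0.
    rewrite -(derive_lincomb pair_basis (pair_coord (h1 - h2)) dD) -pair_basisE.
    exact/derivableP/diff_derivable.
  - by move=> r _; exact: is_derive_mulid.
  - move=> r rP; have [_ hB] := hP _ (conv r rP).
    apply: (le_trans (ler_norm_sum _ _ _)).
    apply: (@le_trans _ _ (\sum_j `|pair_coord (h1 - h2) j| * B)).
      apply: ler_sum => j _; rewrite normrM ler_wpM2l//.
      by have := hB (inr i) j; rewrite addrA.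
    rewrite -mulr_suml mulrC /K -mulrA ler_wpM2l ?sum_pair_coord_le//.
    by have := le_trans (normr_ge0 _) (hB (inr i) (inr i)).
apply: norm_mx_le => [|i j].
  have [q0 hB] := hP 0 ltac:(by rewrite normr0).
  case: (posnP n) => [n0|n_gt0].
    by rewrite [(n + n)%N](_ : _ = 0%N) ?mulr0 ?mul0r// n0.
  have i : 'I_n by exact: Ordinal n_gt0.
  exact: (B0 (le_trans (normr_ge0 _) (hB (inr i) (inr i)))).
have gE (w : V * V) (k : 'I_1) l : grad_p H w.1 w.2 k l =
    'D_(pair_basis (inr l)) (uncurried_hamiltonian F) w.
  by case: w => u q; rewrite grad_pE mxE.
rewrite [X in `|X|](_ : _ = 'D_(pair_basis (inr j)) (uncurried_hamiltonian F) (z s + h1)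
  - 'D_(pair_basis (inr j)) (uncurried_hamiltonian F) (z s + h2)); first exact: entry.
by rewrite mxE [X in _ + X]mxE !gE.
Qed.

End AlongArc.

(** * The feedback trajectories *)

Lemma ler_norm_dist (R : realType) (u v e B : R) :
  `|u - v| <= e -> `|v| <= B -> `|u| <= B + e.
Proof.
by move=> uv vB; rewrite -(subrK v u) addrC (le_trans (ler_normD _ _))// lerD.
Qed.

Lemma pair_quadratic_form (R : realType) n (D : 'I_n + 'I_n -> 'I_n + 'I_n -> R)
    (u v : 'rV[R]_n) :
  \sum_i \sum_j pair_coord (u, v) i * pair_coord (u, v) j * D i j =
  (dot (u *m \matrix_(i, j) D (inl i) (inl j)) u
   + dot (u *m \matrix_(i, j) D (inl i) (inr j)) v)
  + (dot (v *m \matrix_(i, j) D (inr i) (inl j)) u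
   + dot (v *m \matrix_(i, j) D (inr i) (inr j)) v).
Proof.
rewrite !dot_mulmxE big_sumType/=; congr (_ + _); rewrite -big_split/=;
  by apply: eq_bigr => i _; rewrite big_sumType/=; congr (_ + _);
    apply: eq_bigr => j _; rewrite mxE.
Qed.

Section Feedback.
Context {R : realType} {n : nat} (F : 'rV[R]_n -> set 'rV[R]_n).
Context (hSH : SH F) (hC2 : hamiltonian_C2 F).
Local Notation H := (hamiltonian F).
Local Notation V := 'rV[R]_n.

(** [taylor2] in the direction (d, Q d). The second-order term is the
    quadratic form of [riccati_rate], because the mixed second derivatives act
    on d and on Q d, and the symmetric matrix Q can be moved from one side of
    the form to the other. *)
Lemma taylor_hamiltonian (u q d : V) (Q : 'M[R]_n) (e : R) : q != 0 -> Q^T = Q -> 0 <= e ->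
  (forall h : V * V, `|h| <= `|(d, d *m Q)| -> ((u, q) + h).2 != 0 /\
     forall i j, `|hess_entry F i j ((u, q) + h) - hess_entry F i j (u, q)| <= e) ->
  `|H (u + d) (q + d *m Q) - H u q - (dot (grad_x H u q) d + dot (grad_p H u q) (d *m Q))
    - 2^-1 * dot (d *m riccati_rate H u q Q) d|
  <= e * ((n + n)%:R * `|(d, d *m Q)|) ^+ 2.
Proof.
move=> q0 QT e0 hP.
set w := (d, d *m Q).
(* The tube hypothesis is needed along the whole segment from 0 to w. *)
have hr (r : R) : 0 <= r <= 1 -> `|r *: w| <= `|w|.
  by move=> /andP[r0 r1]; rewrite normrZ ger0_norm// ler_piMl.
have := @taylor2 R (V * V)%type _ pair_basis (pair_coord w) [set z | z.2 != 0]
  (uncurried_hamiltonian F) (u, q) e hC2 e0.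
rewrite -pair_basisE => /(_ (fun r rP => (hP _ (hr r rP)).1) (fun r rP => (hP _ (hr r rP)).2)).
have -> : uncurried_hamiltonian F ((u, q) + w) = H (u + d) (q + d *m Q) by [].
have -> : uncurried_hamiltonian F (u, q) = H u q by [].
have -> : \sum_i pair_coord w i * 'D_(pair_basis i) (uncurried_hamiltonian F) (u, q) =
    dot (grad_x H u q) d + dot (grad_p H u q) (d *m Q).
  rewrite big_sumType/= /dot; congr (_ + _); apply: eq_bigr => i _.
    by rewrite grad_xE mxE mulrC.
  by rewrite grad_pE [in RHS]mxE mulrC.
have -> : \sum_i \sum_j pair_coord w i * pair_coord w j *
      'D_(pair_basis j) ('D_(pair_basis i) (uncurried_hamiltonian F)) (u, q) =
    dot (d *m riccati_rate H u q Q) d.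
  set X := hess_xx H u q; set Y := hess_px H u q; set Z := hess_xp H u q; set W := hess_pp H u q.
  have XE : X = \matrix_(i, j) hess_entry F (inl i) (inl j) (u, q).
    by apply/matrixP => i j; rewrite mxE; exact: (hess_xxE hC2 u i j q0).
  have YE : Y = \matrix_(i, j) hess_entry F (inl i) (inr j) (u, q).
    by apply/matrixP => i j; rewrite mxE; exact: (hess_pxE hC2 u i j q0).
  have ZE : Z = \matrix_(i, j) hess_entry F (inr i) (inl j) (u, q).
    by apply/matrixP => i j; rewrite mxE; exact: (hess_xpE hC2 u i j q0).
  have WE : W = \matrix_(i, j) hess_entry F (inr i) (inr j) (u, q).
    by apply/matrixP => i j; rewrite mxE; exact: (hess_ppE hC2 u i j q0).
  clearbody X Y Z W.
  transitivity ((dot (d *m X) d + dot (d *m Y) (d *m Q))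
    + (dot (d *m Q *m Z) d + dot (d *m Q *m W) (d *m Q))).
    rewrite XE YE ZE WE.
    exact: (pair_quadratic_form (fun i j => hess_entry F i j (u, q)) d (d *m Q)).
  have dQ (v : V) : dot v (d *m Q) = dot (v *m Q) d by rewrite dot_mulmx QT.
  rewrite !dQ !mulmxDr !dotDl !mulmxA; ring.
move/le_trans; apply.
rewrite ler_wpM2l// lerXn2r ?nnegrE ?mulr_ge0// ?sumr_ge0//.
exact: sum_pair_coord_le.
Qed.

Context (a T : R) (aT : a <= T) (x p : R -> V) (P : R -> 'M[R]_n).
Context (xc : continuous x) (pc : continuous p) (Pc : continuous P) (p0 : forall s, p s != 0).
Context (xcl : forall s, x (clamp a T s) = x s) (pcl : forall s, p (clamp a T s) = p s)
  (Pcl : forall s, P (clamp a T s) = P s).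
Local Notation z s := (x s, p s).

Lemma feedback_direction_bound : exists2 C : R, 0 < C &
  forall s (u : V), `|(u, u *m P s)| <= C * `|u|.
Proof.
have [BP BP0 BPP] := continuous_bounded_norm aT Pc.
exists (1 + n%:R * BP); first by rewrite ltr_wpDr// mulr_ge0// ltW.
move=> s u; rewrite prod_normE/= ge_max; apply/andP; split.
  by rewrite ler_peMl// lerDl mulr_ge0// ltW.
apply: (le_trans (mulmx_norm_le _ _)).
rewrite -(Pcl s) mulrCA mulrC.
apply: (@le_trans _ _ ((n%:R * BP) * `|u|)).
  by rewrite ler_wpM2r// ler_wpM2l//; apply: BPP; exact: clamp_itv.
by rewrite ler_wpM2r// lerDr.
Qed.

(** The velocity of the displacement d = y - x when y follows the feedback
    grad_p H(y, p + P (y - x)). *)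
Definition feedback_rate (d : V) s :=
  grad_p H (x s + d) (p s + d *m P s) - grad_p H (x s) (p s).

Lemma feedback_lipschitz : exists r L : R, [/\ 0 < r, 0 <= L &
  forall s (d d' : V), `|d| <= r -> `|d'| <= r ->
    p s + d *m P s != 0 /\ `|feedback_rate d s - feedback_rate d' s| <= L * `|d - d'|].
Proof.
have [eta eta0 etaP] := hess_tube hC2 aT xc pc p0 xcl pcl ltr01.
have [B B0 BP] := hess_bound hC2 aT xc pc p0 xcl pcl.
have [C C0 CP] := feedback_direction_bound.
have r0 : 0 < eta / 2 / C by rewrite !divr_gt0.
(* Displacements of norm at most eta / (2 C) stay strictly inside the tube of
   radius eta; there the second derivatives are at most B + 1. *)
exists (eta / 2 / C), ((B + 1) * (n + n)%:R * C); split => //.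
  by rewrite !mulr_ge0 ?addr_ge0// ltW.
have wn s (d : V) : `|d| <= eta / 2 / C -> `|(d, d *m P s)| < eta.
  rewrite ler_pdivlMr// => dr; apply: (le_lt_trans (CP s d)); rewrite mulrC; lra.
move=> s d d' dr d'r; have [q0 _] := etaP s _ (wn s d dr); split; first exact: q0.
rewrite /feedback_rate opprB addrA subrK.
have hB (h : V * V) : `|h| < eta ->
    (z s + h).2 != 0 /\ forall i j, `|hess_entry F i j (z s + h)| <= B + 1.
  move=> hn; have [h2 hh] := etaP s h hn; split => // i j.
  exact: ler_norm_dist (hh i j) (BP s i j).
have := @gradp_lipschitz R n F hC2 x p eta (B + 1) s _ _ hB (wn s d dr) (wn s d' d'r).
rewrite /= => /le_trans; apply; rewrite -[leRHS]mulrA ler_wpM2l//.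
  by rewrite mulr_ge0// addr_ge0// ltW.
have -> : (d, d *m P s) - (d', d' *m P s) = (d - d', (d - d') *m P s).
  by rewrite mulmxBl.
exact: CP.
Qed.

(** The truncated feedback has a global solution. By Gronwall's inequality a
    solution that starts close enough to zero never reaches the truncation
    threshold, so it solves the original equation up to time T. *)
Lemma feedback_solution : exists C r M : R, [/\ 0 < C, 0 < r &
  forall t (d0 : V), a <= t <= T -> C * `|d0| <= r -> exists d : R -> V,
  [/\ continuous d, d t = d0, forall s, t <= s <= T -> `|d s| <= C * `|d0| &
  forall s, t < s < T -> [/\ p s + d s *m P s != 0,
     is_derive s 1 d (feedback_rate (d s) s) & `|feedback_rate (d s) s| <= M]]].
Proof.
have [r [L [r0 L0 LP]]] := feedback_lipschitz.
pose k := @clamp_row R n r.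
have kr v : `|k v| <= r by apply: clamp_row_le; exact: ltW.
pose g s v := feedback_rate (k v) s.
have rate0 s : feedback_rate 0 s = 0 by rewrite /feedback_rate mul0mx !addr0 subrr.
have gL s v : `|g s v| <= L * `|k v|.
  have [_] := LP s (k v) 0 (kr v) ltac:(by rewrite normr0 ltW).
  by rewrite rate0 !subr0.
have gr s v : `|g s v| <= L * r by apply: (le_trans (gL s v)); rewrite ler_wpM2l.
have gLip s u v : `|g s u - g s v| <= (L + 1) * `|u - v|.
  have [_ /le_trans] := LP s (k u) (k v) (kr u) (kr v); apply.
  apply: ler_pM => //; first by rewrite lerDl.
  by apply: clamp_row_lip; exact: ltW.
have gc u : continuous u -> continuous (fun s => g s (u s)).
  move=> uc.
  have kc : continuous (fun s => k (u s)).
    move=> s; apply: (@continuous_comp _ _ _ u k); first exact: uc.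
    exact: clamp_row_continuous.
  have c1 : continuous (fun s => x s + k (u s)).
    by move=> s; apply: cvgD; [exact: xc|exact: kc].
  have c2 : continuous (fun s => p s + k (u s) *m P s).
    by move=> s; apply: cvgD; [exact: pc|exact: (continuous_mulmx kc Pc)].
  have [c3 _] := grad_path_continuous hC2 c1 c2 (fun s => (LP s _ _ (kr (u s)) (kr (u s))).1).
  have [c4 _] := grad_path_continuous hC2 xc pc p0.
  by move=> s; apply: cvgB; [exact: c3|exact: c4].
pose k2 := 2 * (1 * n)%:R * L.
(* X bounds |d s|^2 / |d0|^2; the constant X + 1 avoids a square root. *)
pose X := (1 * n)%:R * expR (k2 * (T - a)).
have k20 : 0 <= k2 by rewrite !mulr_ge0.
have X0 : 0 <= X by rewrite mulr_ge0// expR_ge0.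
exists (X + 1), r, (L * r); split => //; first by rewrite ltr_wpDl.
move=> t d0 /andP[at_ tT] d0r.
have L1 : 1 <= L + 1 by rewrite lerDr.
have [d [dc dt dd]] := @picard R n g (L + 1) (L * r) t d0 L1 (mulr_ge0 L0 (ltW r0)) gc gLip gr.
have dX s : t <= s <= T -> `|d s| <= (X + 1) * `|d0|.
  move=> /andP[ts sT].
  have H1 : sqn (d s) <= sqn (d t) * expR (k2 * (s - t)).
    apply: (@gronwall _ (fun s => sqn (d s))
      (fun s => \sum_ij 2 * (d s ij.1 ij.2 * (g s (d s)) ij.1 ij.2)) t s k2 ts).
    - exact: continuous_sqn.
    - by move=> u /andP[tu _]; apply: is_derive_sqn; exact: dd.
    - move=> u _; apply: (le_trans (ler_norm _)); apply: sqn_deriv_bound => //.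
      apply: (le_trans (gL _ _)); rewrite ler_wpM2l//.
      by apply: clamp_row_norm_le; exact: ltW.
  have H2 : sqn (d s) <= X * `|d0| ^+ 2.
    apply: (le_trans H1); rewrite dt /X [leRHS]mulrAC; apply: ler_pM.
    - exact: sqn_ge0.
    - exact: expR_ge0.
    - exact: sqn_le.
    - by rewrite ler_expR ler_wpM2l//; lra.
  rewrite -(@ler_pXn2r _ 2)// ?nnegrE ?mulr_ge0 ?addr_ge0//.
  apply: (le_trans (norm_sqn _)); apply: (le_trans H2); rewrite exprMn ler_wpM2r ?sqr_ge0//.
  by rewrite sqrrD expr1n mulr1; have := sqr_ge0 X; lra.
exists d; split => // s /andP[ts sT].
have dr : `|d s| <= r by apply: le_trans d0r; apply: dX; rewrite !ltW.
have kd : k (d s) = d s by apply: clamp_row_id.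
have := dd s ts; rewrite /g kd => ds; split => //; first by have [] := LP s (d s) (d s) dr dr.
by have := gr s (d s); rewrite /g kd.
Qed.

(** The function g of the overview. *)
Definition riccati_form (d : R -> V) s : R :=
  dot (p s) (d s) + 2^-1 * dot (d s *m P s) (d s).

Context (PT : forall s, (P s)^T = P s).
Context (xd : forall s, a < s < T -> is_derive s 1 x (grad_p H (x s) (p s)))
  (pd : forall s, a < s < T -> is_derive s 1 p (- grad_x H (x s) (p s)))
  (Pd : forall s, a < s < T -> is_derive s 1 P
    (- riccati_rate H (x s) (p s) (P s))).

(** The terms with the velocity of d combine, by symmetry of P, into <p + P d,
    d'>, which is evaluated by <grad_p H(y, k), k> = H(y, k) at both points;
    the first-order adjoint equation and the Riccati equation provide the rest
    of the Taylor polynomial. *)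
Lemma riccati_form_derive (d : R -> V) s : a < s < T ->
  p s + d s *m P s != 0 -> is_derive s 1 d (feedback_rate (d s) s) ->
  is_derive s 1 (riccati_form d)
   (H (x s + d s) (p s + d s *m P s) - H (x s) (p s)
    - (dot (grad_x H (x s) (p s)) (d s) + dot (grad_p H (x s) (p s)) (d s *m P s))
    - 2^-1 * dot (d s *m riccati_rate H (x s) (p s) (P s)) (d s)).
Proof.
move=> sab q0 dd.
have D1 := is_derive_dot (pd sab) dd.
have D2 := is_derive_dot (is_derive_mulmx dd (Pd sab)) dd.
have D3 : is_derive s 1 (2^-1 *: (fun s => dot (d s *m P s) (d s))) _ := is_deriveZ 2^-1 D2.
have := is_deriveD D1 D3.
set S := hess_px _ _ _ *m _ + _ + _ + _.
set gx := grad_x _ _ _; set gp := grad_p _ _ _; set v := feedback_rate _ _.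
rewrite [X in is_derive _ _ _ X -> _](_ : _ =
    H (x s + d s) (p s + d s *m P s) - H (x s) (p s)
    - (dot gx (d s) + dot gp (d s *m P s)) - 2^-1 * dot (d s *m S) (d s)) //.
have [_ HE] := grad_p_argmax hSH (differentiable_snd (hamiltonian_diff hC2 (x s) (p0 s))).
have [_ HE'] := grad_p_argmax hSH (differentiable_snd (hamiltonian_diff hC2 (x s + d s) q0)).
rewrite -[H (x s) (p s)]HE -[H (x s + d s) _]HE'.
have -> : grad (H (x s)) (p s) = gp by [].
have -> : dot (grad (H (x s + d s)) (p s + d s *m P s)) (p s + d s *m P s) =
   dot v (p s + d s *m P s) + dot gp (p s + d s *m P s).
  by rewrite -dotDl /v /feedback_rate subrK.
rewrite /GRing.scale/= mulmxN dotNl dotDl dotNl.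
have -> : dot (v *m P s) (d s) = dot v (d s *m P s) by rewrite dot_mulmx PT.
clearbody v gx gp S; rewrite !dotDr (dotC (d s *m P s) v) (dotC (p s) v); by field.
Qed.

Lemma riccati_form_estimate (C e : R) : 0 < C -> 0 < e -> exists2 r : R, 0 < r &
  forall t (d : R -> V), a <= t <= T -> continuous d ->
  (forall s, t <= s <= T -> `|d s| <= C * `|d t|) ->
  (forall s, t < s < T ->
     p s + d s *m P s != 0 /\ is_derive s 1 d (feedback_rate (d s) s)) ->
  `|d t| < r -> `|riccati_form d T - riccati_form d t| <= e * `|d t| ^+ 2.
Proof.
move=> C0 e0.
have [Cw Cw0 CwP] := feedback_direction_bound.
pose N : R := ((n + n)%:R * (Cw * C)) ^+ 2.
have N0 : 0 <= N by exact: sqr_ge0.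
pose e' := e / (N * (T - a) + 1).
have D0 : 0 < N * (T - a) + 1 by rewrite ltr_wpDl// mulr_ge0// subr_ge0.
have e'0 : 0 < e' by rewrite divr_gt0.
have [eta eta0 etaP] := hess_tube hC2 aT xc pc p0 xcl pcl e'0.
exists (eta / (Cw * C)); first by rewrite divr_gt0// mulr_gt0.
move=> t d /andP[at_ tT] dc dC dd; rewrite ltr_pdivlMr ?mulr_gt0// => dr.
pose K := e' * (N * `|d t| ^+ 2).
have wle s : t <= s <= T -> `|(d s, d s *m P s)| <= Cw * C * `|d t|.
  move=> sP; apply: (le_trans (CwP s (d s))); rewrite -mulrA ler_wpM2l ?(ltW Cw0)//.
  exact: dC.
have H1 : `|riccati_form d T - riccati_form d t| <= T * K - t * K.
  apply: (@mvt_dominated R (riccati_form d) (fun s => s * K)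
   (fun s => H (x s + d s) (p s + d s *m P s) - H (x s) (p s)
    - (dot (grad_x H (x s) (p s)) (d s) + dot (grad_p H (x s) (p s)) (d s *m P s))
    - 2^-1 * dot (d s *m riccati_rate H (x s) (p s) (P s)) (d s))
    (fun=> K) t T tT).
  - apply: continuous_subspaceT => s; apply: cvgD; first exact: (continuous_dot pc dc).
    by apply: cvgM; [exact: cvg_cst|exact: (continuous_dot (continuous_mulmx dc Pc) dc)].
  - apply: continuous_subspaceT => s.
    by apply: cvgM; [exact: cvg_id|exact: cvg_cst].
  - move=> s sP; have [q0 ds] := dd s sP.
    by apply: riccati_form_derive => //; lra.
  - by move=> s _; exact: is_derive_mulid.
  - move=> s sP; have sP' : t <= s <= T by lra.
    have wls := wle s sP'.
    apply: (le_trans (@taylor_hamiltonian (x s) (p s) (d s) (P s) e' (p0 s) (PT s) (ltW e'0) _)).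
      by move=> h hw; apply: etaP; apply: (le_lt_trans hw); apply: (le_lt_trans wls); rewrite mulrC.
    rewrite /K ler_wpM2l ?(ltW e'0)// /N -exprMn lerXn2r ?nnegrE ?mulr_ge0// ?(ltW Cw0) ?(ltW C0)//.
    by rewrite -mulrA ler_wpM2l.
apply: (le_trans H1); rewrite -mulrBl /K.
have -> : e * `|d t| ^+ 2 = (N * (T - a) + 1) * (e' * `|d t| ^+ 2).
  by rewrite /e'; field; rewrite gt_eqF.
rewrite [leLHS](_ : _ = (N * (T - t)) * (e' * `|d t| ^+ 2)); last first.
  by clearbody N e'; ring.
have E0 : 0 <= e' * `|d t| ^+ 2 by apply: mulr_ge0; [exact: ltW|exact: sqr_ge0].
rewrite ler_wpM2r//.
have : N * (T - t) <= N * (T - a) by rewrite ler_wpM2l//; lra.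
lra.
Qed.

End Feedback.

(** * Superjets of the value function *)

Lemma within_continuous_clamp (R : realType) (T : topologicalType) (f : R -> T) (a b : R) :
  a <= b -> {within `[a, b], continuous f} -> continuous (fun s => f (clamp a b s)).
Proof.
move=> ab /subspace_continuousP fc s.
have cP r : `[a, b]%classic (clamp a b r) by rewrite /= in_itv/= clamp_itv.
move=> U /(fc _ (cP s)).
rewrite /fmap/= nbhs_simpl => H.
have K := @clamp_continuous R a b s _ H.
apply: (@filterS _ (nbhs s) (nbhs_filter s) _ _ _ K) => r Hr; exact: (Hr (cP r)).
Qed.

Section Bound.
Context {R : realType} {n : nat} (T : R)
    (F : 'rV[R]_n -> set 'rV[R]_n) (phi : 'rV[R]_n -> R)
    (hSH : SH F) (hH : hamiltonian_C2 F) (hphi : locally_lipschitz phi)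
    (t0 : R) (x0 : 'rV[R]_n) (ht0 : t0 <= T)
    (x : R -> 'rV[R]_n) (hx : optimal F phi T t0 x0 x)
    (q : 'rV[R]_n) (Q : 'M[R]_n)
    (hqQ : superjet phi (x T) (q, Q)) (hq : q != 0)
    (p : R -> 'rV[R]_n) (hp : dual_arc F phi T t0 x p) (hpT : - p T = q)
    (a : R) (hat0 : t0 <= a) (haT : a < T)
    (P : R -> 'M[R]_n) (hP : riccati_solution F x p a T (- Q) P).
Local Notation H := (hamiltonian F).
Local Notation V := 'rV[R]_n.
Local Notation xc := (fun s => x (clamp a T s)).
Local Notation pc := (fun s => p (clamp a T s)).
Local Notation Pc := (fun s => P (clamp a T s)).

Let aT : a <= T := ltW haT.

Let x_ac i : scalar_ac (fun s => x s 0 i) a T.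
Proof.
have [[/abs_continuousP xac _ _] _] := hx.
exact: scalar_ac_sub (xac i).
Qed.

Let p_ac i : scalar_ac (fun s => p s 0 i) a T.
Proof.
have [/abs_continuousP pac _ _] := hp.
exact: scalar_ac_sub (pac i).
Qed.

Let xc_continuous : continuous xc.
Proof.
move=> s; apply: cvg_mx => i j; rewrite ord1.
exact: (scalar_ac_clamp_continuous aT (x_ac j)).
Qed.

Let pc_continuous : continuous pc.
Proof.
move=> s; apply: cvg_mx => i j; rewrite ord1.
exact: (scalar_ac_clamp_continuous aT (p_ac j)).
Qed.

Let Pc_continuous : continuous Pc.
Proof. by have [PW _ _] := hP; exact: within_continuous_clamp. Qed.

Let pc_neq0 s : pc s != 0.
Proof.
have [[xac _ _] _] := hx.
have pT : p T != 0 by rewrite -oppr_eq0 hpT.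
have /andP[as_ sT] := clamp_itv s aT.
by apply: (dual_arc_neq0 hSH ht0 xac hp pT); rewrite sT (le_trans hat0).
Qed.

Let clamp_idem (f : R -> V) s : f (clamp a T (clamp a T s)) = f (clamp a T s).
Proof. by rewrite (clamp_id (clamp_itv s aT)). Qed.

Let clamp_near (W : Type) (f : R -> W) s :
  a < s < T -> \forall r \near s, f r = f (clamp a T r).
Proof.
move=> sab; have : nbhs s `]a, T[%classic by apply: near_in_itvoo; rewrite in_itv.
apply: filterS => r /=; rewrite in_itv/= => rab.
by rewrite clamp_id//; lra.
Qed.

(** H(x, .) is differentiable at p, so its subdifferential is its gradient:
    the inclusion valid almost everywhere prescribes a continuous derivative.
    *)
Let xc_derive s : a < s < T -> is_derive s 1 xc (grad_p H (xc s) (pc s)).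
Proof.
move=> sab; apply: (is_derive_near_eq (clamp_near x sab)).
have [gpc _] := grad_path_continuous hH xc_continuous pc_continuous pc_neq0.
apply/is_derive_mxP => i j; rewrite ord1 {i}.
apply: (@scalar_ac_ae_C1 R (fun s => x s 0 j)
  (fun s => grad_p H (xc s) (pc s) 0 j) a T aT) => //.
  move=> r; exact: (continuous_entry gpc).
have [_ pae _] := hp.
apply: ae_impl pae => r Hr /andP[ar rT].
have [|dx dp fp fx] := Hr; first by rewrite rT (le_trans hat0).
have := derivable_is_derive1 dx => /is_derive_mxP/(_ 0 j)/is_derive1E[d1 ->]; split => //.
have rP : a <= r <= T by rewrite ar.
rewrite clamp_id//; have p0 := pc_neq0 r; rewrite /= clamp_id// in p0.
by rewrite (frechet_grad (differentiable_snd (hamiltonian_diff hH (x r) p0)) fp).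
Qed.

Let pc_derive s : a < s < T -> is_derive s 1 pc (- grad_x H (xc s) (pc s)).
Proof.
move=> sab; apply: (is_derive_near_eq (clamp_near p sab)).
have [_ gxc] := grad_path_continuous hH xc_continuous pc_continuous pc_neq0.
apply/is_derive_mxP => i j; rewrite ord1 {i} mxE.
apply: (@scalar_ac_ae_C1 R (fun s => p s 0 j)
  (fun s => - grad_x H (xc s) (pc s) 0 j) a T aT) => //.
  move=> r; apply: cvgN.
  exact: (continuous_entry gxc).
have [_ pae _] := hp.
apply: ae_impl pae => r Hr /andP[ar rT].
have [|dx dp fp fx] := Hr; first by rewrite rT (le_trans hat0).
have := derivable_is_derive1 dp => /is_derive_mxP/(_ 0 j)/is_derive1E[d1 ->]; split => //.
have rP : a <= r <= T by rewrite ar.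
rewrite clamp_id//; have p0 := pc_neq0 r; rewrite /= clamp_id// in p0.
have := frechet_grad (@differentiable_fst _ _ (uncurried_hamiltonian F) _ _
  (hamiltonian_diff hH (x r) p0)) fx.
by move=> /(congr1 (fun v : V => - v 0 j)); rewrite mxE opprK.
Qed.

Let Pc_derive s : a < s < T -> is_derive s 1 Pc
    (- riccati_rate H (xc s) (pc s) (Pc s)).
Proof.
move=> sab; apply: (is_derive_near_eq (clamp_near P sab)).
have [_ /(_ s sab)[dP E] _] := hP.
have sP : a <= s <= T by lra.
rewrite clamp_id//.
have := derivable_is_derive1 dP.
rewrite [X in is_derive _ _ _ X -> _](_ : _ = - riccati_rate H (x s) (p s) (P s))//.
by apply/eqP; rewrite -addr_eq0 !addrA; apply/eqP.
Qed.

Let Pc_symmetric s : (Pc s)^T = Pc s.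
Proof.
have PT : (Pc T)^T = Pc T.
  have [_ _ PT] := hP; have [QT _] := hqQ.
  by rewrite clamp_id ?lexx ?aT// PT linearN/= QT.
have := riccati_symmetric hH xc_continuous pc_continuous pc_neq0 aT Pc_continuous Pc_derive PT
  (clamp_itv s aT).
by rewrite /= (clamp_id (clamp_itv s aT)).
Qed.

(** The velocity of x + d is a gradient of H in the costate variable at a
    nonzero covector, hence lies in F. *)
Let neighbour_trajectory t (d : R -> V) (M : R) : a <= t <= T -> continuous d ->
  (forall s, t < s < T -> [/\ pc s + d s *m Pc s != 0,
     is_derive s 1 d (feedback_rate F xc pc Pc (d s) s) &
     `|feedback_rate F xc pc Pc (d s) s| <= M]) ->
  trajectory F T t (x t + d t) (fun s => x s + d s).
Proof.
move=> /andP[at_ tT] dc dd; split => //.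
  apply/abs_continuousP => i.
  have -> : (fun s => (x s + d s) 0 i) = (fun s => x s 0 i + d s 0 i).
    by apply/funext => s; rewrite mxE.
  apply: scalar_acD; first exact: scalar_ac_sub (x_ac i).
  apply: (@scalar_ac_derive R (fun s => d s 0 i)
    (fun s => feedback_rate F xc pc Pc (d s) s 0 i) t T M tT).
  - move=> s; exact: (continuous_entry dc).
  - by move=> s /dd[_ /is_derive_mxP].
  - by move=> s /dd[_ _]; apply: le_trans; exact: coord_norm_le.
apply: ae_impl2 (ae_neq t) (ae_neq T) => s st sT /andP[ts sT'].
have stT : t < s < T by rewrite !lt_neqAle ts sT' eq_sym st sT.
have saT : a < s < T by case/andP : stT => ts' ->; rewrite (le_lt_trans at_).
have sP : a <= s <= T by lra.
have [q0 ds _] := dd s stT.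
have dx : is_derive s 1 x (grad_p H (xc s) (pc s)).
  apply: is_derive_near_eq (xc_derive saT).
  by near=> r; apply/esym; near: r; exact: clamp_near.
have [d1 ->] := is_derive1E (is_deriveD dx ds); split => //.
rewrite [X in F _ X](_ : _ = grad_p H (xc s + d s) (pc s + d s *m Pc s)); last first.
  by rewrite /feedback_rate addrC subrK.
have := grad_p_argmax hSH (differentiable_snd (hamiltonian_diff hH (xc s + d s) q0)).
by rewrite clamp_id//; case.
Unshelve. all: by end_near. Qed.

Lemma riccati_solution_symmetric t : a <= t <= T -> (P t)^T = P t.
Proof. by move=> tP; have := Pc_symmetric t; rewrite clamp_id. Qed.

(** The cost of the feedback trajectory, expanded with the superjet of phi at
    x T; the error terms of phi and of the Riccati form are both measured by
    |d0|^2. *)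
Lemma value_quadratic_bound t (e : R) : a <= t <= T -> 0 < e ->
  exists2 rho : R, 0 < rho & forall d0 : V, `|d0| < rho ->
    value F phi T t (x t + d0) <=
      phi (x T) - dot (p t) d0 - 2^-1 * dot (d0 *m P t) d0 + e * `|d0| ^+ 2.
Proof.
move=> tP e0.
have xcl s : xc (clamp a T s) = xc s by exact: clamp_idem.
have pcl s : pc (clamp a T s) = pc s by exact: clamp_idem.
have Pcl s : Pc (clamp a T s) = Pc s by rewrite /= (clamp_id (clamp_itv s aT)).
have [C [r [M [C0 r0 sol]]]] := feedback_solution hH aT xc_continuous pc_continuous Pc_continuous
  pc_neq0 xcl pcl Pcl.
have [QT [rem [/eqoP remo [delta delta0 phiP]]]] := hqQ.
pose N : R := n%:R * C.
have N0 : 0 <= N by rewrite mulr_ge0// ltW.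
pose e1 := e / 2 / (N ^+ 2 + 1).
have e10 : 0 < e1 by rewrite !divr_gt0// ltr_wpDl// sqr_ge0.
have := remo e1 e10 => /(@nbhs_ballP _ _ (x T))[b /= b0 bP].
have e20 : 0 < e / 2 by rewrite divr_gt0.
have [rho1 rho10 rho1P] := riccati_form_estimate hSH hH aT xc_continuous pc_continuous Pc_continuous
  pc_neq0 xcl pcl Pcl Pc_symmetric pc_derive Pc_derive C0 e20.
have [tle Tle] : t <= t <= T /\ t <= T <= T by move/andP: tP => [_ ->]; rewrite !lexx.
exists (Order.min (Order.min rho1 (r / C)) (Order.min (b / C) (delta / (N + 1)))).
  by rewrite !lt_min rho10 !divr_gt0// ltr_wpDl.
move=> d0; rewrite !lt_min => /andP[/andP[d0rho1 d0r] /andP[d0b d0delta]].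
have {}d0r : C * `|d0| <= r by rewrite mulrC -ler_pdivlMr// ltW.
have {}d0b : C * `|d0| < b by rewrite mulrC -ltr_pdivlMr.
have {}d0delta : N * `|d0| <= delta.
  move: d0delta; rewrite ltr_pdivlMr ?ltr_wpDl// => /ltW; apply: le_trans.
  by rewrite mulrC ler_wpM2l// lerDl.
have [d [dc dt dle dd]] := sol t d0 tP d0r.
have yt := neighbour_trajectory tP dc dd.
rewrite -dt; apply: (le_trans (value_le hSH hphi _ yt)); first by case/andP : tP.
have dT := dle T Tle.
have dTe : enorm (d T) <= N * `|d0|.
  by apply: (le_trans (enorm_le_norm _)); rewrite /N -mulrA ler_wpM2l.
have remT : rem (x T + d T) <= e / 2 * `|d0| ^+ 2.
  have /bP : ball (x T) b (x T + d T).
    by rewrite -ball_normE/= opprD addNKr normrN (le_lt_trans dT).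
  move=> /(le_trans (ler_norm _)) H1; apply: (le_trans H1).
  rewrite addrC addKr ger0_norm ?sqr_ge0//.
  apply: (@le_trans _ _ (e1 * (N * `|d0|) ^+ 2)).
    apply: ler_wpM2l; first exact: ltW.
    by rewrite lerXn2r ?nnegrE ?enorm_ge0//; apply: mulr_ge0.
  rewrite exprMn mulrA ler_wpM2r ?sqr_ge0// /e1 mulrAC ler_pdivrMr ?ltr_wpDl ?sqr_ge0//.
  by rewrite ler_wpM2l ?(ltW e20)// lerDl.
have := phiP (x T + d T); rewrite /eball/= addrC addKr addrC.
move=> /(_ (le_trans dTe d0delta)) phiT.
have := rho1P t d tP dc; rewrite dt => /(_ dle _ d0rho1) form.
have {}form := form (fun s sP => let: And3 q0 ds _ := dd s sP in conj q0 ds).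
move: form.
have cT : clamp a T T = T by rewrite clamp_id// lexx aT.
have ct : clamp a T t = t by rewrite clamp_id.
rewrite /riccati_form cT ct dt ler_norml => /andP[form _].
have [_ _ PT] := hP.
have E1 : dot q (d T) = - dot (p T) (d T) by rewrite -hpT dotNl.
have E2 : dot (d T *m Q^T) (d T) = - dot (d T *m P T) (d T).
  by rewrite PT mulmxN dotNl opprK QT.
move: phiT; rewrite /= E1 E2 => phiT.
rewrite (addrC (x T)) in remT.
lra.
Qed.

End Bound.

Theorem theorem3p6 (R : realType) (n : nat) (T : R)
    (F : 'rV[R]_n -> set 'rV[R]_n) (phi : 'rV[R]_n -> R)
    (hSH : SH F) (hH : hamiltonian_C2 F) (hphi : locally_lipschitz phi)
    (t0 : R) (x0 : 'rV[R]_n) (ht0 : t0 <= T)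
    (x : R -> 'rV[R]_n) (hx : optimal F phi T t0 x0 x)
    (q : 'rV[R]_n) (Q : 'M[R]_n)
    (hqQ : superjet phi (x T) (q, Q)) (hq : q != 0)
    (p : R -> 'rV[R]_n) (hp : dual_arc F phi T t0 x p) (hpT : - p T = q)
    (a : R) (hat0 : t0 <= a) (haT : a < T)
    (P : R -> 'M[R]_n) (hP : riccati_solution F x p a T (- Q) P) :
  forall t : R, a <= t <= T ->
    superjet (value F phi T t) (x t) (- p t, - P t).
Proof.
move=> t tP.
have PtT : (P t)^T = P t by apply: riccati_solution_symmetric tP; eauto.
split; first by rewrite /= linearN/= PtT.
(* The error term is the positive part of the defect: the superjet inequality
   then holds everywhere, and only its size has to be estimated. *)
pose quad y := value F phi T t (x t) + dot (- p t) (y - x t)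
  + 2^-1 * dot ((y - x t) *m (- P t)^T) (y - x t).
exists (fun y => Order.max 0 (value F phi T t y - quad y)); split; last first.
  exists 1 => // y _; rewrite -/(quad y) -lerBlDl le_max lexx orbT//.
apply/eqoP => e e0.
have [rho rho0 rhoP] := value_quadratic_bound hSH hH hphi ht0 hx hqQ hq hp hpT hat0 haT hP tP e0.
apply/(@nbhs_ballP _ _ (x t)); exists rho => //= y; rewrite -ball_normE/= => yrho.
rewrite ger0_norm ?le_max ?lexx// ger0_norm ?sqr_ge0//.
rewrite ge_max mulr_ge0 ?sqr_ge0 ?(ltW e0)//=.
have := rhoP (y - x t); rewrite distrC => /(_ yrho); rewrite addrC subrK (distrC (x t)) => H.
rewrite lerBlDr; apply: (le_trans H).
have t0t : t0 <= t by case/andP : tP => at_ _; exact: le_trans at_.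
have tT : t <= T by case/andP : tP.
rewrite /quad (value_on_optimal hSH hphi t0t tT hx) dotNl linearN/= PtT mulmxN dotNl.
have : e * `|y - x t| ^+ 2 <= e * enorm (y - x t) ^+ 2.
  by rewrite ler_wpM2l ?(ltW e0)// lerXn2r ?nnegrE ?enorm_ge0// norm_enorm_le.
lra.
Qed.
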